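(* Let $M$ be a compact complex manifold of dimension $n$ and $L,L'$ holomorphic Hermitian line bundles over $M$ with real-analytic metrics, $L$ positive. Let $U$ be a coordinate domain of $M$ as in the context, and let $\tilde a_{\ell,\alpha,\beta}: U\times\overline{U}\to\mathbb{C}$ ($\ell\in\mathbb{N}$, $\alpha,\beta\in\mathbb{N}^n$, $|\alpha|,|\beta|\leqslant\ell$) be the holomorphic functions defined in the context. Then for any compact subset $K$ of $U\times\overline{U}$, there exists $C>0$ such that for any $\ell,\alpha,\beta$, $$ |\tilde a_{\ell,\alpha,\beta}(x,y_c)|\leqslant C^{\ell+1},\qquad \forall (x,y_c)\in K. $$
   Context: $\overline{M}$ is $M$ with the opposite complex structure, $\overline{x}\in\overline M$ corresponds to $x\in M$, and the diagonal $\{(x,\overline{x})\}\subset M\times\overline{M}$ is identified with $M$; a tilde denotes a holomorphic extension from the diagonal to a neighborhood of it. $U$ is a connected open set of $M$ which is the domain of a holomorphic chart, used to identify $U$ with an open set of $\mathbb{C}^n$ (and $\overline{U}$ with $\{\overline{z}: z\in U\}$), and on which $L$ and $L'$ have holomorphic frames $s,s'$. Set $|s|^2=e^{-\varphi}$, $|s'|^2=e^{-\varphi'}$ and $G_{ij}=\partial^2\varphi/\partial z_i\partial\overline{z}_j$, which is positive definite. $U$ is small enough that $\varphi,\varphi'$ have holomorphic extensions $\tilde\varphi,\tilde\varphi'$ to $U\times\overline{U}$ and that $b$ below has a holomorphic extension to $U\times\overline{U}$. Let $\delta=\det(G_{ij})$ (the density of the Liouville measure) and $$\psi(x,y)=-\tilde\varphi(x,\overline{y})-\tilde\varphi(y,\overline{x})+\tilde\varphi(x,\overline{x})+\tilde\varphi(y,\overline{y}),$$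 with $\psi'$ defined by the same formula with $\tilde\varphi'$ in place of $\tilde\varphi$. For real-analytic functions $f,g$ with holomorphic extensions $\tilde f,\tilde g$ near the diagonal and $\ell\in\mathbb{N}$, define $$A_\ell(f,g)(x)=b(x)\sum_{m=0}^{2\ell}\frac{\Delta^{\ell+m}(c^m\,d\,c')}{m!(\ell+m)!}(x,0),\qquad x\in U,$$ where, for $u\in\mathbb{C}^n$ small, $b(x)=(\det(G_{ij}(x)))^{-1}$, $c(x,u)=\sum_{i,j}G_{ij}(x)u_i\overline{u}_j-\psi(x,x+u)$, $d(x,u)=\tilde f(x,\overline{x}+\overline{u})\,\tilde g(x+u,\overline{x})$, $c'(x,u)=e^{-\psi'(x,x+u)}\delta(x+u)$, and $\Delta=\sum_{i,j}G^{ij}(x)\partial_{u_i}\partial_{\overline{u}_j}$ with $(G^{ij}(x))$ the inverse of $(G_{ij}(x))$, indices being paired so that $\sum_jG_{ij}G^{kj}=\delta_{ik}$ (the Kronecker symbol). These are bidifferential operators of the form $$\frac{1}{\ell!}A_\ell(f,g)=\sum_{|\alpha|,|\beta|\leqslant\ell}a_{\ell,\alpha,\beta}\,\frac{(\partial_{\overline{z}}^\beta f)(\partial_z^\alpha g)}{\alpha!\,\beta!}$$ with uniquely determined real-analytic coefficients $a_{\ell,\alpha,\beta}$ on $U$, each of which has a holomorphic extension $\tilde a_{\ell,\alpha,\beta}$ to $U\times\overline{U}$ (that is, $a_{\ell,\alpha,\beta}(x)=\tilde a_{\ell,\alpha,\beta}(x,\overline{x})$). *)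

(* Defs.v *)
From HB Require Import structures.
From mathcomp Require Import all_boot all_order all_algebra.
From mathcomp Require Import all_classical all_reals all_analysis.
From mathcomp Require Import complex.
From mathcomp.analysis.showcase Require summability.

Set Implicit Arguments.
Unset Strict Implicit.
Unset Printing Implicit Defensive.

Import Order.TTheory GRing.Theory Num.Theory numFieldNormedType.Exports.

Local Open Scope classical_set_scope.
Local Open Scope ring_scope.
Local Open Scope complex_scope.

(* R[i] packaged as a numClosedFieldType: in this form it carries the topology
   that MathComp-Analysis puts on every numFieldType, and 'rV[CC R]_n the
   corresponding product topology. *)
Definition CC (R : realType) : numClosedFieldType := R[i].

Definition conjv (R : realType) (n : nat) (x : 'rV[CC R]_n) : 'rV[CC R]_n :=
  map_mx (@conjc R) x.

Definition cexp (R : realType) (z : CC R) : CC R :=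
  (expR (complex.Re z))%:C * (cos (complex.Im z) +i* sin (complex.Im z)).

Definition multi (n : nat) := {ffun 'I_n -> nat}.

Definition mabs (n : nat) (al : multi n) : nat := (\sum_i al i)%N.

Definition mfact (n : nat) (al : multi n) : nat := (\prod_i (al i)`!)%N.

Definition monom (K : comNzRingType) (n : nat) (al : multi n) (u : 'rV[K]_n) : K :=
  \prod_i u 0 i ^+ al i.

Definition multi_of_ord (n k : nat) (al : {ffun 'I_n -> 'I_k}) : multi n :=
  [ffun i => nat_of_ord (al i)].

(* Weierstrass' definition of holomorphy in several variables: near a, f is the
   unconditional sum of a power series in the coordinates of u = z - a. The
   filter [totally] expresses convergence along the finite sets of
   multi-indices ordered by inclusion. *)
Definition holomorphic_at (R : realType) (N : nat) (f : 'rV[CC R]_N -> CC R)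
    (a : 'rV[CC R]_N) : Prop :=
  exists (c : multi N -> CC R) (r : R), 0 < r /\
    forall u : 'rV[CC R]_N, (forall i, `|u 0 i| < r%:C :> CC R) ->
      summability.partial_sum (fun al => c al * monom al u)
        @ summability.totally --> f (a + u).

(* All sets W to which this is applied are open. *)
Definition holomorphic_on (R : realType) (N : nat) (W : set 'rV[CC R]_N)
    (f : 'rV[CC R]_N -> CC R) : Prop :=
  forall a, W a -> holomorphic_at f a.

(* Power series in the 2n real coordinates of C^n. *)
Definition real_analytic_at (R : realType) (n : nat) (f : 'rV[CC R]_n -> R)
    (a : 'rV[CC R]_n) : Prop :=
  exists (c : multi (n + n) -> R) (r : R), 0 < r /\
    forall u : 'rV[CC R]_n, (forall i, `|u 0 i| < r%:C :> CC R) ->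
      summability.partial_sum (fun al => c al *
          monom al (row_mx (map_mx (@complex.Re R) u) (map_mx (@complex.Im R) u)))
        @ summability.totally --> f (a + u).

Definition real_analytic_on (R : realType) (n : nat) (W : set 'rV[CC R]_n)
    (f : 'rV[CC R]_n -> R) : Prop :=
  forall a, W a -> real_analytic_at f a.

(* The derivative at t = 0 of the curve t |-> f (x + t v), for t real. *)
Definition dirder (R : realType) (n : nat) (v : 'rV[CC R]_n)
    (f : 'rV[CC R]_n -> CC R) (x : 'rV[CC R]_n) : CC R :=
  derive1 (fun t : R => complex.Re (f (x + (t%:C : CC R) *: v))) 0 +i*
  derive1 (fun t : R => complex.Im (f (x + (t%:C : CC R) *: v))) 0.

(* Wirtinger derivatives d/dz_i and d/d(conjugate of z_i). *)
Definition dz (R : realType) (n : nat) (i : 'I_n)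
    (f : 'rV[CC R]_n -> CC R) (x : 'rV[CC R]_n) : CC R :=
  2^-1 * (dirder (delta_mx 0 i) f x
          - 'i%C * dirder (('i%C : CC R) *: delta_mx 0 i) f x).

Definition dzbar (R : realType) (n : nat) (i : 'I_n)
    (f : 'rV[CC R]_n -> CC R) (x : 'rV[CC R]_n) : CC R :=
  2^-1 * (dirder (delta_mx 0 i) f x
          + 'i%C * dirder (('i%C : CC R) *: delta_mx 0 i) f x).

Definition dzs (R : realType) (n : nat) (al : multi n)
    (f : 'rV[CC R]_n -> CC R) : 'rV[CC R]_n -> CC R :=
  foldr (fun i g => iter (al i) (dz i) g) f (enum 'I_n).

Definition dzbars (R : realType) (n : nat) (be : multi n)
    (f : 'rV[CC R]_n -> CC R) : 'rV[CC R]_n -> CC R :=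
  foldr (fun i g => iter (be i) (dzbar i) g) f (enum 'I_n).

Definition levi (R : realType) (n : nat) (phi : 'rV[CC R]_n -> R)
    (x : 'rV[CC R]_n) : 'M[CC R]_n :=
  \matrix_(i, j) dz i (dzbar j (fun z => (phi z)%:C)) x.

(* In R[i], 0 < z means that z is real and positive. *)
Definition posdef (R : realType) (n : nat) (A : 'M[CC R]_n) : Prop :=
  forall v : 'rV[CC R]_n, v != 0 ->
    0 < \sum_i \sum_j A i j * v 0 i * conjc (v 0 j) :> CC R.

(* A chart with its inverse; only the values of cmap on cdom and those of cinv
   on the image of the chart are meaningful. *)
Record chart (R : realType) (n : nat) (M : topologicalType) := Chart {
  cdom : set M;
  cmap : M -> 'rV[CC R]_n;
  cinv : 'rV[CC R]_n -> M }.

Definition cimage (R : realType) (n : nat) (M : topologicalType)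
    (k : chart R n M) (A : set M) : set 'rV[CC R]_n :=
  cmap k @` (cdom k `&` A).

Definition is_chart (R : realType) (n : nat) (M : topologicalType)
    (k : chart R n M) : Prop :=
  [/\ open (cdom k),
      open (cimage k setT),
      (forall p, cdom k p -> cinv k (cmap k p) = p),
      {within cdom k, continuous (cmap k)} &
      {within cimage k setT, continuous (cinv k)}].

Definition holomorphic_transition (R : realType) (n : nat) (M : topologicalType)
    (k k' : chart R n M) : Prop :=
  forall j, holomorphic_on (cimage k (cdom k'))
              (fun z => cmap k' (cinv k z) 0 j).

Record complex_manifold (R : realType) (n : nat) := ComplexManifold {
  cm_space :> topologicalType;
  cm_atlas : set (chart R n cm_space);
  cm_hausdorff : hausdorff_space cm_space;
  cm_chart : forall k, cm_atlas k -> is_chart k;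
  cm_cover : forall p, exists2 k, cm_atlas k & cdom k p;
  cm_compat : forall k k', cm_atlas k -> cm_atlas k' ->
    holomorphic_transition k k' }.

Definition holomorphic_chart (R : realType) (n : nat) (M : complex_manifold R n)
    (k : chart R n M) : Prop :=
  is_chart k /\ forall k', cm_atlas k' ->
    holomorphic_transition k k' /\ holomorphic_transition k' k.

Definition holomorphic_fun (R : realType) (n : nat) (M : complex_manifold R n)
    (A : set M) (g : M -> CC R) : Prop :=
  forall k : chart R n M, cm_atlas k ->
    holomorphic_on (cimage k A) (fun z => g (cinv k z)).

(* A family of complex lines with a covering collection of local frames whose
   transition functions are holomorphic. A local frame is a pair (open set,
   section), the section being meaningful on the open set only. *)
Record line_bundle (R : realType) (n : nat) (M : complex_manifold R n) :=
  LineBundle {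
  fibre : M -> lmodType (CC R);
  lb_frames : set (set M * (forall x, fibre x));
  lb_open : forall F, lb_frames F -> open F.1;
  lb_basis : forall F, lb_frames F -> forall x, F.1 x ->
    forall v : fibre x, exists! a : CC R, v = a *: F.2 x;
  lb_cover : forall x, exists2 F, lb_frames F & F.1 x;
  lb_compat : forall F F', lb_frames F -> lb_frames F' ->
    exists2 g : M -> CC R, holomorphic_fun (F.1 `&` F'.1) g &
      forall x, F.1 x -> F'.1 x -> F'.2 x = g x *: F.2 x }.

Definition holomorphic_frame (R : realType) (n : nat) (M : complex_manifold R n)
    (L : line_bundle M) (V : set M) (s : forall x, fibre L x) : Prop :=
  [/\ open V,
      (forall x, V x -> s x != 0) &
      forall F, lb_frames F ->
        exists2 g : M -> CC R, holomorphic_fun (V `&` F.1) g &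
          forall x, V x -> F.1 x -> s x = g x *: F.2 x].

Record hermitian_metric (R : realType) (n : nat) (M : complex_manifold R n)
    (L : line_bundle M) := HermitianMetric {
  herm : forall x, fibre L x -> fibre L x -> CC R;
  herm_linear : forall x (a : CC R) (u v w : fibre L x),
    herm (a *: u + v) w = a * herm u w + herm v w;
  herm_conj : forall x (u v : fibre L x), herm u v = conjc (herm v u);
  herm_pos : forall x (v : fibre L x), v != 0 -> 0 < herm v v }.

Definition normsq (R : realType) (n : nat) (M : complex_manifold R n)
    (L : line_bundle M) (h : hermitian_metric L) (x : M) (v : fibre L x) : R :=
  complex.Re (herm h v v).

Definition real_analytic_metric (R : realType) (n : nat)
    (M : complex_manifold R n) (L : line_bundle M)
    (h : hermitian_metric L) : Prop :=
  forall (k : chart R n M) (V : set M) (s : forall x, fibre L x),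
    cm_atlas k -> holomorphic_frame V s ->
    real_analytic_on (cimage k V) (fun z => normsq h (s (cinv k z))).

(* The function phi with |s|^2 = exp (- phi), read in the chart k. *)
Definition weight (R : realType) (n : nat) (M : complex_manifold R n)
    (L : line_bundle M) (h : hermitian_metric L) (k : chart R n M)
    (s : forall x, fibre L x) (z : 'rV[CC R]_n) : R :=
  - ln (normsq h (s (cinv k z))).

(* The curvature of the Chern connection of h is, in a local holomorphic frame
   and local coordinates, the (1,1)-form with coefficients levi (weight h k s). *)
Definition positive_metric (R : realType) (n : nat) (M : complex_manifold R n)
    (L : line_bundle M) (h : hermitian_metric L) : Prop :=
  forall (k : chart R n M) (V : set M) (s : forall x, fibre L x),
    holomorphic_chart k -> holomorphic_frame V s ->
    forall x, cimage k V x -> posdef (levi (weight h k s) x).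

(* C^n x C^n is represented by 'rV_(n + n); the second block of a point of
   U x Ubar is the conjugate of a point of U. *)
Definition diag (R : realType) (n : nat) (x : 'rV[CC R]_n) : 'rV[CC R]_(n + n) :=
  row_mx x (conjv x).

Definition UxUbar (R : realType) (n : nat) (U : set 'rV[CC R]_n) :
    set 'rV[CC R]_(n + n) :=
  [set w | exists x y, [/\ U x, U y & w = row_mx x (conjv y)]].

Definition hol_extension (R : realType) (n : nat) (U : set 'rV[CC R]_n)
    (W : set 'rV[CC R]_(n + n)) (f : 'rV[CC R]_n -> CC R)
    (ft : 'rV[CC R]_(n + n) -> CC R) : Prop :=
  holomorphic_on W ft /\ forall x, U x -> ft (diag x) = f x.

Definition psi (R : realType) (n : nat) (phit : 'rV[CC R]_(n + n) -> CC R)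
    (x y : 'rV[CC R]_n) : CC R :=
  - phit (row_mx x (conjv y)) - phit (row_mx y (conjv x))
  + phit (diag x) + phit (diag y).

Definition bfun (R : realType) (n : nat) (phi : 'rV[CC R]_n -> R)
    (x : 'rV[CC R]_n) : CC R :=
  (\det (levi phi x))^-1.

Definition cfun (R : realType) (n : nat) (phi : 'rV[CC R]_n -> R)
    (phit : 'rV[CC R]_(n + n) -> CC R) (x u : 'rV[CC R]_n) : CC R :=
  (\sum_i \sum_j levi phi x i j * u 0 i * conjc (u 0 j)) - psi phit x (x + u).

Definition dfun (R : realType) (n : nat) (ft gt : 'rV[CC R]_(n + n) -> CC R)
    (x u : 'rV[CC R]_n) : CC R :=
  ft (row_mx x (conjv x + conjv u)) * gt (row_mx (x + u) (conjv x)).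

Definition cfun' (R : realType) (n : nat) (phi : 'rV[CC R]_n -> R)
    (phit' : 'rV[CC R]_(n + n) -> CC R) (x u : 'rV[CC R]_n) : CC R :=
  cexp (- psi phit' x (x + u)) * \det (levi phi (x + u)).

(* G^{ij} is characterized by \sum_j G_ij G^{kj} = delta_ik, hence the
   transpose of the inverse matrix. *)
Definition Lap (R : realType) (n : nat) (phi : 'rV[CC R]_n -> R)
    (x : 'rV[CC R]_n) (F : 'rV[CC R]_n -> CC R) (u : 'rV[CC R]_n) : CC R :=
  \sum_i \sum_j (invmx (levi phi x))^T i j * dz i (dzbar j F) u.

Definition A_op (R : realType) (n : nat) (phi : 'rV[CC R]_n -> R)
    (phit phit' : 'rV[CC R]_(n + n) -> CC R) (l : nat)
    (ft gt : 'rV[CC R]_(n + n) -> CC R) (x : 'rV[CC R]_n) : CC R :=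
  bfun phi x * \sum_(m < (2 * l)%N.+1)
    iter (l + m)%N (Lap phi x)
      (fun u => cfun phi phit x u ^+ m * dfun ft gt x u * cfun' phi phit' x u) 0
    / (m`! * (l + m)`!)%N%:R.

(* a l al be extends holomorphically to U x Ubar the coefficient a_{l, al, be}
   of the bidifferential operator A_l / l!. A function f having a holomorphic
   extension ft to a neighbourhood W of the diagonal is in particular
   real-analytic, so this is not repeated as a hypothesis. *)
Definition bidiff_coefficients (R : realType) (n : nat) (U : set 'rV[CC R]_n)
    (phi : 'rV[CC R]_n -> R) (phit phit' : 'rV[CC R]_(n + n) -> CC R)
    (a : nat -> multi n -> multi n -> 'rV[CC R]_(n + n) -> CC R) : Prop :=
  (forall l (al be : multi n), (mabs al <= l)%N -> (mabs be <= l)%N ->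
     holomorphic_on (UxUbar U) (a l al be)) /\
  (forall l (W : set 'rV[CC R]_(n + n)) (f g : 'rV[CC R]_n -> CC R)
      (ft gt : 'rV[CC R]_(n + n) -> CC R),
    open W -> (forall x, U x -> W (diag x)) ->
    hol_extension U W f ft -> hol_extension U W g gt ->
    forall x, U x ->
      (l`!%:R)^-1 * A_op phi phit phit' l ft gt x =
      \sum_(al : {ffun 'I_n -> 'I_l.+1} | (mabs (multi_of_ord al) <= l)%N)
      \sum_(be : {ffun 'I_n -> 'I_l.+1} | (mabs (multi_of_ord be) <= l)%N)
        a l (multi_of_ord al) (multi_of_ord be) (diag x)
        * (dzbars (multi_of_ord be) f x * dzs (multi_of_ord al) g x
           / (mfact (multi_of_ord al) * mfact (multi_of_ord be))%N%:R)).

(* Main.v *)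
Require Import Defs.
From mathcomp Require Import all_boot all_order all_algebra.
From mathcomp Require Import finmap perm.
From mathcomp Require Import all_classical all_reals all_analysis.
From mathcomp Require Import complex.
From mathcomp Require Import ring lra zify.
From mathcomp.analysis.showcase Require summability.

Set Implicit Arguments.
Unset Strict Implicit.
Unset Printing Implicit Defensive.

Import Order.TTheory GRing.Theory Num.Theory numFieldNormedType.Exports.
Local Open Scope classical_set_scope.
Local Open Scope ring_scope.
Local Open Scope complex_scope.

(** The coefficient a_(l,al,be) is computed explicitly, the formula is continued
    off the diagonal, and the continued formula is estimated by Cauchy bounds.

    On the diagonal.  Fix x in U and test the bidifferential identity on the
    polynomials f(z) = (conj z - conj x)^be and g(z) = (z - x)^al.  Only the term
    (al, be) survives on the right, and d(x,u) = u^al (conj u)^be on the left, so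
      a_(l,al,be)(x) = b(x)/l! * sum_(m <= 2l)
         Lap^(l+m) (c^m u^al (conj u)^be c') (0) / (m! (l+m)!).
    Near u = 0 every function on the right is a convergent power series in
    (u, conj u), and the Wirtinger derivatives act on the coefficients as formal
    derivatives (dexpands_wirtinger).  Hence the right-hand side is a polynomial
    in b, in the Taylor coefficients at (x, conj x) of phit, of exp(phit'), of
    exp(-phit') and of det G, and in 1/l!, 1/(m! (l+m)!).

    Off the diagonal.  Taylor coefficients of a holomorphic function are
    holomorphic functions of the base point (taylor_analytic), so that polynomial,
    written at an arbitrary point w of U x Ubar, is a holomorphic function
    coef_ext l al be.  The inverse of G is written b * adj G, which is holomorphic
    at every point of U x Ubar.  The diagonal is totally real and U is connected,
    so coef_ext agrees with the given extension (identity_theorem).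

    Bounds.  Near a point of U x Ubar the weighted l1 norms
      sum_ga |c_ga| r^|ga|
    of the series of c and c' are at most constants Mc, Mc' for one radius r <= 1.
    The norm is submultiplicative, so the series of c^m u^al v^be c' has norm at
    most Mc^m Mc'.  Since Lap^k of such a series at 0 is at most
    const^k (k!)^2 times its norm (lap_coef_bound0), the m-th term, divided by
    m! (l+m)! l!, is at most const^(l+m) (l+m)!/(m! l!) <= const^(l+m) 2^(l+m).
    As m <= 2l, this is geometric in l; compactness of K makes the constant
    uniform.

    All analysis is done with unconditionally summable families: re-centring of
    a power series, products and the exponential of a power series are instances
    of one Fubini statement (has_sum_fibres). *)

(** * The modulus as a real number *)

Definition rc (R : realType) (x : R) : CC R := x%:C.

(** The norm of CC R takes its values in CC R; real estimates need it in R. *)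
Definition cmod (R : realType) (z : CC R) : R := Normc.normc z.

Section Modulus.
Variable R : realType.
Implicit Types z w : CC R.

Lemma rcD (x y : R) : rc (x + y) = rc x + rc y.
Proof. exact: rmorphD. Qed.

Lemma rcN (x : R) : rc (- x) = - rc x.
Proof. exact: rmorphN. Qed.

Lemma rcM (x y : R) : rc (x * y) = rc x * rc y.
Proof. exact: rmorphM. Qed.

Lemma rcX (x : R) k : rc (x ^+ k) = rc x ^+ k.
Proof. exact: rmorphXn. Qed.

Lemma rc_nat k : rc (k%:R : R) = k%:R.
Proof. exact: rmorph_nat. Qed.

Lemma rcI : injective (@rc R).
Proof. exact: complexI. Qed.

Lemma cmodE z : `|z| = rc (cmod z).
Proof. by []. Qed.

Lemma cmod_ge0 z : 0 <= cmod z.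
Proof. by rewrite -ler0c -[_%:C]/(rc _) -cmodE normr_ge0. Qed.

Lemma cmod0 : cmod (0 : CC R) = 0.
Proof. by apply: rcI; rewrite -cmodE normr0. Qed.

Lemma cmod1 : cmod (1 : CC R) = 1.
Proof. by apply: rcI; rewrite -cmodE normr1. Qed.

Lemma cmodN z : cmod (- z) = cmod z.
Proof. by apply: rcI; rewrite -!cmodE normrN. Qed.

Lemma cmodM z w : cmod (z * w) = cmod z * cmod w.
Proof. by apply: rcI; rewrite rcM -!cmodE normrM. Qed.

Lemma cmodV z : cmod z^-1 = (cmod z)^-1.
Proof. by rewrite /cmod Normc.normcV. Qed.

Lemma cmodX z k : cmod (z ^+ k) = cmod z ^+ k.
Proof. by elim: k => [|k IH]; rewrite ?expr0 ?cmod1 // !exprS cmodM IH. Qed.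

Lemma cmodD z w : cmod (z + w) <= cmod z + cmod w.
Proof. by rewrite -lecR -[leLHS]/(rc _) -[leRHS]/(rc _) rcD -!cmodE ler_normD. Qed.

Lemma cmodB z w : cmod (z - w) <= cmod z + cmod w.
Proof. by rewrite -(cmodN w) cmodD. Qed.

Lemma cmod_eq0 z : cmod z = 0 -> z = 0.
Proof. by move=> h; apply/eqP; rewrite -normr_eq0 cmodE h. Qed.

Lemma rc_sum (I : Type) (r : seq I) (P : pred I) (f : I -> R) :
  rc (\sum_(i <- r | P i) f i) = \sum_(i <- r | P i) rc (f i).
Proof. exact: rmorph_sum. Qed.

Lemma rc_ReIm z : z = rc (complex.Re z) + 'i%C * rc (complex.Im z).
Proof. exact: complexE. Qed.

Lemma cmod_real (x : R) : cmod (rc x) = `|x|.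
Proof. by rewrite /cmod /= expr0n /= addr0 sqrtr_sqr. Qed.

Lemma cmod_nat k : cmod (k%:R : CC R) = k%:R.
Proof.
by rewrite -rc_nat cmod_real normr_nat.
Qed.

Lemma cmod_conj z : cmod (conjc z) = cmod z.
Proof. by case: z => a b; rewrite /cmod /= sqrrN. Qed.

Lemma cmod_Re z : `|complex.Re z| <= cmod z.
Proof. by rewrite -lecR -[leRHS]/(rc _) -cmodE normc_ge_Re. Qed.

Lemma cmod_Im z : `|complex.Im z| <= cmod z.
Proof.
have -> : complex.Im z = - complex.Re (z * 'i%C) by rewrite ReiNIm opprK.
rewrite normrN; apply: (le_trans (cmod_Re _)).
by rewrite cmodM [cmod 'i%C](_ : _ = 1) ?mulr1 // /cmod /= expr0n /= add0r expr1n sqrtr1.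
Qed.

Lemma cmod_sum (I : Type) (r : seq I) (P : pred I) (f : I -> CC R) :
  cmod (\sum_(i <- r | P i) f i) <= \sum_(i <- r | P i) cmod (f i).
Proof.
elim/big_ind2: _ => [|x1 x2 y1 y2 h1 h2|//]; first by rewrite cmod0.
by apply: (le_trans (cmodD _ _)); rewrite lerD.
Qed.

Lemma cmod_prod (I : Type) (r : seq I) (P : pred I) (f : I -> CC R) :
  cmod (\prod_(i <- r | P i) f i) = \prod_(i <- r | P i) cmod (f i).
Proof. by elim/big_ind2: _ => [|x1 x2 y1 y2 <- <-|//]; rewrite ?cmod1 ?cmodM. Qed.

End Modulus.

(** * Unconditional sums *)

Definition has_sum (R : realType) (I : choiceType) (f : I -> CC R) (s : CC R) :=
  forall e : R, 0 < e -> exists J0 : {fset I}, forall J : {fset I},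
    (J0 `<=` J)%fset -> cmod (\sum_(i <- J) f i - s) < e.

(** For a nonnegative family this is summability with total at most B. *)
Definition sums_le (R : realType) (I : choiceType) (f : I -> R) (B : R) :=
  forall J : {fset I}, \sum_(i <- J) f i <= B.

Section Sums.
Variable R : realType.
Local Notation K := (CC R).

Lemma fset_sum_incl (V : zmodType) (I : choiceType) (f : I -> V) (A B : {fset I}) :
  (A `<=` B)%fset -> (forall i, i \in B -> i \notin A -> f i = 0) ->
  \sum_(i <- B) f i = \sum_(i <- A) f i.
Proof. by move=> AB h; symmetry; apply: big_fset_incl. Qed.

Lemma fset_sum_le (I : choiceType) (f : I -> R) (A B : {fset I}) :
  (forall i, 0 <= f i) -> (A `<=` B)%fset ->
  \sum_(i <- A) f i <= \sum_(i <- B) f i.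
Proof.
move=> f0 AB; rewrite [leRHS](big_fsetID _ (mem A)) /=.
have -> : [fset x | x in B & x \in A]%fset = A.
  apply/fsetP => i; rewrite !inE /= andbC.
  by case: (boolP (i \in A)) => // /(fsubsetP AB) ->.
by rewrite lerDl sumr_ge0.
Qed.

Lemma has_sum_unique (I : choiceType) (f : I -> K) s t :
  has_sum f s -> has_sum f t -> s = t.
Proof.
move=> fs ft; apply/eqP; rewrite -subr_eq0; apply/eqP/cmod_eq0.
apply/eqP; rewrite eq_le cmod_ge0 andbT; apply/ler_addgt0Pr => e e0.
have e2 : 0 < e / 2 by lra.
have [J1 h1] := fs _ e2; have [J2 h2] := ft _ e2.
have {}h1 := h1 _ (fsubsetUl J1 J2); have {}h2 := h2 _ (fsubsetUr J1 J2).
set S := \sum_(i <- _) _ in h1 h2.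
have -> : s - t = (S - t) - (S - s) by ring.
by have := cmodB (S - t) (S - s); lra.
Qed.

Lemma eq_has_sum (I : choiceType) (f g : I -> K) s :
  f =1 g -> has_sum f s -> has_sum g s.
Proof. by move=> /funext ->. Qed.

Lemma has_sum_fin (I : choiceType) (f : I -> K) (A : {fset I}) :
  (forall i, i \notin A -> f i = 0) -> has_sum f (\sum_(i <- A) f i).
Proof.
move=> h e e0; exists A => J AJ; rewrite (fset_sum_incl AJ) ?subrr ?cmod0 //.
by move=> i _; apply: h.
Qed.

Lemma has_sum0 (I : choiceType) : has_sum (fun _ : I => 0 : K) 0.
Proof. by move=> e e0; exists fset0 => J _; rewrite big1 // subrr cmod0. Qed.

Lemma has_sumD (I : choiceType) (f g : I -> K) s t :
  has_sum f s -> has_sum g t -> has_sum (fun i => f i + g i) (s + t).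
Proof.
move=> fs gt e e0; have e2 : 0 < e / 2 by lra.
have [J1 h1] := fs _ e2; have [J2 h2] := gt _ e2.
exists (J1 `|` J2)%fset => J; rewrite fsubUset => /andP[/h1 {}h1 /h2 {}h2].
rewrite big_split /= [_ - _](_ : _ = (\sum_(i <- J) f i - s) + (\sum_(i <- J) g i - t)).
  by apply: (le_lt_trans (cmodD _ _)); lra.
ring.
Qed.

Lemma has_sumZ (I : choiceType) (f : I -> K) s (a : K) :
  has_sum f s -> has_sum (fun i => a * f i) (a * s).
Proof.
move=> fs e e0; have ha : 0 < e / (cmod a + 1).
  by rewrite divr_gt0 // ltr_wpDl ?cmod_ge0.
have [J0 h] := fs _ ha; exists J0 => J /h {}h.
rewrite -mulr_sumr -mulrBr cmodM.
apply: (le_lt_trans (y := (cmod a + 1) * cmod (\sum_(i <- J) f i - s))).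
  by rewrite ler_wpM2r ?cmod_ge0 // lerDl.
by rewrite mulrC -ltr_pdivlMr // ltr_wpDl ?cmod_ge0.
Qed.

Lemma has_sum_sum (I : choiceType) (T : Type) (r : seq T) (f : T -> I -> K) (s : T -> K) :
  (forall t, has_sum (f t) (s t)) ->
  has_sum (fun i => \sum_(t <- r) f t i) (\sum_(t <- r) s t).
Proof.
move=> h; elim: r => [|t r IH].
  rewrite big_nil; apply: eq_has_sum (@has_sum0 I) => i; by rewrite big_nil.
rewrite big_cons; apply: eq_has_sum (has_sumD (h t) IH) => i; by rewrite big_cons.
Qed.

Lemma has_sum_cmod_le (I : choiceType) (f : I -> K) s (B : R) :
  sums_le (fun i => cmod (f i)) B -> has_sum f s -> cmod s <= B.
Proof.
move=> fB fs; apply/ler_addgt0Pr => e e0; have [J h] := fs _ e0.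
have {}h := h _ (fsubset_refl J); have hB := fB J.
have := cmod_sum J xpredT f; set S := \sum_(i <- _) f _ in h *.
have := cmodB S (S - s); rewrite [S - (S - s)](_ : _ = s); last ring.
move: h hB; rewrite /=; lra.
Qed.

Lemma has_sum_nneg_exists (I : choiceType) (g : I -> R) (B : R) :
  (forall i, 0 <= g i) -> sums_le g B ->
  exists s : R, has_sum (fun i => rc (g i)) (rc s).
Proof.
move=> g0 gB; pose S := [set x | exists J : {fset I}, x = \sum_(i <- J) g i].
have hS : has_sup S.
  split; first by exists (\sum_(i <- fset0) g i), fset0.
  by exists B => x [J ->].
exists (sup S) => e e0; have [x [J0 ->] hx] := sup_adherent e0 hS.
exists J0 => J JJ; rewrite [_ - _](_ : _ = rc (\sum_(i <- J) g i - sup S)).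
  rewrite cmod_real distrC ger0_norm.
    have := fset_sum_le g0 JJ; lra.
  rewrite subr_ge0; apply: ub_le_sup; last by exists J.
  by exists B => y [J' ->].
by rewrite rcD rcN rc_sum.
Qed.

Lemma sums_le_trans (I : choiceType) (f g : I -> R) (B : R) :
  (forall i, f i <= g i) -> sums_le g B -> sums_le f B.
Proof. by move=> fg gB J; apply: le_trans (gB J); apply: ler_sum. Qed.

Lemma sums_le_ge0 (I : choiceType) (f : I -> R) (B : R) : sums_le f B -> 0 <= B.
Proof. by move=> /(_ fset0); rewrite big_nil. Qed.

Lemma sums_leZ (I : choiceType) (f : I -> R) (a B : R) :
  0 <= a -> sums_le f B -> sums_le (fun i => a * f i) (a * B).
Proof. by move=> a0 fB J; rewrite -mulr_sumr ler_wpM2l. Qed.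

Lemma sums_leD (I : choiceType) (f g : I -> R) (A B : R) :
  sums_le f A -> sums_le g B -> sums_le (fun i => f i + g i) (A + B).
Proof. by move=> fA gB J; rewrite big_split lerD. Qed.

Lemma sums_le_term (I : choiceType) (f : I -> R) (B : R) i : sums_le f B -> f i <= B.
Proof. by move=> /(_ [fset i]%fset); rewrite big_seq_fset1. Qed.

(** Summability is reduced to the nonnegative case, where the total is a
    supremum, by splitting into positive and negative parts of the real and
    imaginary parts. *)
Lemma has_sum_exists (I : choiceType) (f : I -> K) (B : R) :
  sums_le (fun i => cmod (f i)) B -> exists s, has_sum f s.
Proof.
move=> fB.
have part (g : I -> R) : (forall i, `|g i| <= cmod (f i)) ->
    exists s : R, has_sum (fun i => rc (g i)) (rc s).
  move=> gf.
  have [|| s1 h1] := @has_sum_nneg_exists I (fun i => Num.max (g i) 0) B.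
  - by move=> i; rewrite le_max lexx orbT.
  - by apply: sums_le_trans fB => i; rewrite ge_max cmod_ge0 andbT (le_trans (ler_norm _)).
  have [|| s2 h2] := @has_sum_nneg_exists I (fun i => Num.max (- g i) 0) B.
  - by move=> i; rewrite le_max lexx orbT.
  - apply: sums_le_trans fB => i; rewrite ge_max cmod_ge0 andbT (le_trans (ler_norm _)) //.
    by rewrite normrN.
  exists (s1 - s2); have := has_sumD h1 (has_sumZ (-1) h2).
  rewrite mulN1r -(rcN s2) -(rcD s1); apply: eq_has_sum => i.
  rewrite mulN1r -(rcN (Num.max (- g i) 0)) -rcD; congr (rc _).
  have [h|/ltW h] := leP 0 (g i).
    by rewrite (max_idPr _) ?oppr_le0 // subr0.
  by rewrite (max_idPl _) ?oppr_ge0 // sub0r opprK.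
have [s1 h1] := part _ (fun i => cmod_Re (f i)).
have [s2 h2] := part _ (fun i => cmod_Im (f i)).
exists (rc s1 + 'i%C * rc s2); apply: eq_has_sum (has_sumD h1 (has_sumZ _ h2)) => i.
by rewrite -rc_ReIm.
Qed.

(** Fubini along the fibres of h, the source of all rearrangements below: h = fst
    or snd gives iterated sums, h = addition of indices gives Cauchy products.
    A finite sum of g over a set L of indices is close to the sum of f over the
    points of a large finite set lying above L; once L contains the image of a
    set beyond which the sums of f have settled, the latter is close to s. *)
Lemma has_sum_fibres (I J : choiceType) (h : I -> J) (f : I -> K) (g : J -> K) s :
  has_sum f s ->
  (forall j, has_sum (fun i => if h i == j then f i else 0) (g j)) ->
  has_sum g s.
Proof.
move=> fs fg e e0; have e2 : 0 < e / 2 by lra.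
have [J0 hJ0] := fs _ e2.
exists (h @` J0)%fset => L J0L.
(* The error allowed on each of the fibres over L, whose total stays below e / 2. *)
pose d := e / 2 / (#|` L|%:R + 1).
have d0 : 0 < d by rewrite divr_gt0 // ltr_wpDl.
pose A j := sval (cid (fg j d d0)).
have hA j : forall J : {fset I}, (A j `<=` J)%fset ->
    cmod (\sum_(i <- J) (if h i == j then f i else 0) - g j) < d.
  by rewrite /A; case: (cid _).
pose B := (J0 `|` \bigcup_(j <- L) A j)%fset.
have AB j : j \in L -> (A j `<=` B)%fset.
  by move=> jL; apply: fsubset_trans (fsubsetUr _ _); apply: (bigfcup_sup _ jL).
pose B' := [fset i in B | h i \in L]%fset.
have J0B' : (J0 `<=` B')%fset.
  apply/fsubsetP => i iJ; rewrite !inE /= iJ /=.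
  by apply: (fsubsetP J0L); apply: in_imfset.
have E : \sum_(i <- B') f i =
    \sum_(j <- L) \sum_(i <- B) (if h i == j then f i else 0).
  rewrite exchange_big /= big_fset /= [LHS]big_mkcond /=.
  apply: eq_bigr => i _; case: ifP => hi.
    rewrite (big_fsetD1 _ hi) /= eqxx big1_fset ?addr0 // => j.
    by rewrite !inE eq_sym => /andP[/negPf ->].
  rewrite big1_fset // => j jL _; case: eqP => // jE.
  by rewrite jE jL in hi.
have := hJ0 _ J0B'; rewrite E => h1.
set S1 := \sum_(j <- L) \sum_(i <- B) _ in h1.
have h2 : cmod (\sum_(j <- L) g j - S1) <= \sum_(j <- L) d.
  rewrite -sumrB; apply: (le_trans (cmod_sum _ _ _)).
  rewrite big_seq [leRHS]big_seq; apply: ler_sum => j jL.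
  by rewrite -cmodN opprB ltW // hA // AB.
have h3 : \sum_(j <- L) d <= e / 2.
  have -> : \sum_(j <- L) d = #|` L|%:R * d.
    by rewrite big_const_seq count_predT iter_addr_0 mulr_natl.
  have n0 : 0 < (#|` L|%:R + 1 : R) by rewrite ltr_wpDl.
  rewrite /d mulrCA; apply: ler_piMr; first lra.
  rewrite ler_pdivrMr // mul1r; lra.
rewrite [_ - _](_ : _ = (\sum_(j <- L) g j - S1) + (S1 - s)); last ring.
by have := cmodD (\sum_(j <- L) g j - S1) (S1 - s); lra.
Qed.

Lemma sums_le_fibres (I J : choiceType) (h : I -> J) (f : I -> R) (g : J -> R) B :
  (forall i, 0 <= f i) ->
  (forall j, sums_le (fun i => if h i == j then f i else 0) (g j)) ->
  sums_le g B -> sums_le f B.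
Proof.
move=> f0 fg gB A; apply: le_trans (gB (h @` A)%fset).
have -> : \sum_(i <- A) f i =
    \sum_(j <- (h @` A)%fset) \sum_(i <- A) (if h i == j then f i else 0).
  rewrite exchange_big /= big_seq [RHS]big_seq; apply: eq_bigr => i iA.
  rewrite (big_fsetD1 (h i)) ?in_imfset //= eqxx big1_fset ?addr0 // => j.
  by rewrite !inE eq_sym => /andP[/negPf ->].
by apply: ler_sum => j _; apply: fg.
Qed.

(** The elements of the preimage are recovered one at a time by choice. *)
Lemma fset_preimage (I J : choiceType) (k : I -> J) (L : {fset J}) :
  injective k -> exists A : {fset I}, forall i, (i \in A) = (k i \in L).
Proof.
move=> kinj.
exists (seq_fset tt (pmap (fun j => if pselect (exists i, j = k i) is left p
   then Some (sval (cid p)) else None) L)) => i.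
rewrite seq_fsetE mem_pmap; apply/mapP/idP => [[j jL]|kL].
  by case: pselect => // p [->]; case: (cid p) => /= i' <-.
exists (k i) => //; case: pselect => [p|[]]; last by exists i.
by congr Some; case: (cid p) => /= i' /kinj.
Qed.

Lemma sum_preimage (V : zmodType) (I J : choiceType) (k : I -> J) (f : J -> V)
    (A : {fset I}) (L : {fset J}) :
  injective k -> (forall j, f j <> 0 -> exists i, j = k i) ->
  (forall i, (i \in A) = (k i \in L)) ->
  \sum_(i <- A) f (k i) = \sum_(j <- L) f j.
Proof.
move=> kinj fk memA.
have -> : \sum_(i <- A) f (k i) = \sum_(j <- (k @` A)%fset) f j.
  by rewrite big_imfset //= => ? ? _ _; apply: kinj.
symmetry; apply: fset_sum_incl.
  by apply/fsubsetP => j /imfsetP[i /= iA ->]; rewrite -memA.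
move=> j jL jA; apply: contrapT => /fk[i ji]; move/negP: jA; apply.
by rewrite ji in_imfset //= memA -ji.
Qed.

Lemma has_sum_reindex (I J : choiceType) (k : I -> J) (f : J -> K) s :
  injective k -> (forall j, f j <> 0 -> exists i, j = k i) ->
  has_sum (f \o k) s -> has_sum f s.
Proof.
move=> kinj fk fs e e0; have [J0 hJ0] := fs _ e0.
exists (k @` J0)%fset => L J0L; have [A memA] := fset_preimage L kinj.
have := hJ0 A; rewrite (sum_preimage kinj fk memA); apply.
by apply/fsubsetP => i iJ; rewrite memA (fsubsetP J0L) ?in_imfset.
Qed.

Lemma sums_le_reindex (I J : choiceType) (k : I -> J) (f : J -> R) B :
  injective k -> (forall j, f j <> 0 -> exists i, j = k i) ->
  sums_le (f \o k) B -> sums_le f B.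
Proof.
move=> kinj fk fs L; have [A memA] := fset_preimage L kinj.
by have := fs A; rewrite (sum_preimage kinj fk memA).
Qed.

Lemma sums_le_prod (I J : choiceType) (f : I -> R) (g : J -> R) A B :
  (forall i, 0 <= f i) -> (forall j, 0 <= g j) ->
  sums_le f A -> sums_le g B -> sums_le (fun p : I * J => f p.1 * g p.2) (A * B).
Proof.
move=> f0 g0 fA gB; apply: (@sums_le_fibres _ _ fst _ (fun i => f i * B)).
- by move=> [i j]; rewrite mulr_ge0.
- move=> i; apply: (@sums_le_reindex _ _ (pair i)) => [? ? [] //||].
    by move=> [i' j] /=; case: eqP => // -> _; exists j.
  by move=> L /=; rewrite eqxx -mulr_sumr ler_wpM2l.
move=> L; rewrite -mulr_suml ler_wpM2r //; exact: sums_le_ge0 gB.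
Qed.

Lemma has_sum_iter (I J : choiceType) (f : I * J -> K) (g : I -> K) s :
  has_sum f s -> (forall i, has_sum (fun j => f (i, j)) (g i)) -> has_sum g s.
Proof.
move=> fs fg; apply: (has_sum_fibres (h := fst) fs) => i.
apply: (@has_sum_reindex _ _ (pair i)) => [? ? [] //||].
  by move=> [i' j] /=; case: eqP => // -> _; exists j.
by apply: eq_has_sum (fg i) => j /=; rewrite eqxx.
Qed.

Lemma has_sum_prod (I J : choiceType) (f : I -> K) (g : J -> K) A B s t :
  sums_le (fun i => cmod (f i)) A -> sums_le (fun j => cmod (g j)) B ->
  has_sum f s -> has_sum g t -> has_sum (fun p : I * J => f p.1 * g p.2) (s * t).
Proof.
move=> fA gB fs gt.
have fgAB : sums_le (fun p : I * J => cmod (f p.1 * g p.2)) (A * B).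
  have := sums_le_prod (fun i => cmod_ge0 (f i)) (fun j => cmod_ge0 (g j)) fA gB.
  by apply: sums_le_trans => p; rewrite cmodM.
have [w hw] := has_sum_exists fgAB.
suff -> : s * t = w by [].
have h i : has_sum (fun j => f i * g j) (f i * t) by apply: has_sumZ.
have := has_sum_iter hw h; apply: has_sum_unique.
by rewrite mulrC; apply: eq_has_sum (has_sumZ t fs) => i; rewrite mulrC.
Qed.

Lemma sums_le_fin (I : choiceType) (f : I -> R) (A : {fset I}) :
  (forall i, 0 <= f i) -> (forall i, i \notin A -> f i = 0) ->
  sums_le f (\sum_(i <- A) f i).
Proof.
move=> f0 fA L; rewrite -(@fset_sum_incl _ _ f A (A `|` L)%fset).
- by apply: fset_sum_le => //; apply: fsubsetUr.
- exact: fsubsetUl.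
- by move=> i _; apply: fA.
Qed.

(** Converse of sums_le_fibres: finite parts A j of distinct fibres are disjoint,
    so grouping the terms of f by them does not increase finite sums. *)
Lemma sums_le_push (I J : choiceType) (h : I -> J) (f : I -> R) (A : J -> {fset I}) B :
  (forall i, 0 <= f i) -> (forall j i, i \in A j -> h i = j) ->
  sums_le f B -> sums_le (fun j => \sum_(i <- A j) f i) B.
Proof.
move=> f0 hA fB L; apply: le_trans (fB (\bigcup_(j <- L) A j)%fset).
set U := (\bigcup_(j <- L) A j)%fset.
have AU j : j \in L -> (A j `<=` U)%fset by move=> jL; apply: (bigfcup_sup _ jL).
have E : \sum_(j <- L) \sum_(i <- A j) f i =
    \sum_(j <- L) \sum_(i <- U) (if i \in A j then f i else 0).
  rewrite big_seq [RHS]big_seq; apply: eq_bigr => j jL.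
  rewrite (@fset_sum_incl _ _ _ (A j) U (AU j jL)).
    by rewrite big_seq [RHS]big_seq; apply: eq_bigr => i ->.
  by move=> i _ /negPf ->.
rewrite E exchange_big /=; apply: ler_sum => i _.
have [hL|hL] := boolP (h i \in L).
  rewrite (big_fsetD1 _ hL) /= big1_fset ?addr0; first by case: ifP.
  by move=> j; rewrite !inE => /andP[jh _]; case: ifP => // /hA E'; rewrite E' eqxx in jh.
rewrite big1_fset // => j jL _; case: ifP => // /hA E'.
by rewrite E' jL in hL.
Qed.

Lemma has_sum_nneg_le (I : choiceType) (g : I -> R) (s : R) :
  (forall i, 0 <= g i) -> has_sum (fun i => rc (g i)) (rc s) -> sums_le g s.
Proof.
move=> g0 gs L; apply/ler_addgt0Pr => e e0; have [J0 h] := gs _ e0.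
have {h} := h _ (fsubsetUl J0 L).
rewrite -rc_sum -(rcN s) -rcD cmod_real => h.
have := fset_sum_le g0 (fsubsetUr J0 L).
by have := ler_norm (\sum_(i <- (J0 `|` L)%fset) g i - s); lra.
Qed.

Lemma sums_le_section (I J : choiceType) (f : I * J -> R) B i :
  (forall p, 0 <= f p) -> sums_le f B -> sums_le (fun j => f (i, j)) B.
Proof.
move=> f0 fB L; have := fB [fset (i, j) | j in L]%fset.
by rewrite big_imfset //= => ? ? _ _ [].
Qed.

(** The witness S i is the total of the i-th section, which is smaller than any
    other bound on that section. *)
Lemma sums_le_iter (I J : choiceType) (f : I * J -> R) B :
  (forall p, 0 <= f p) -> sums_le f B ->
  exists2 S : I -> R, (forall i, sums_le (fun j => f (i, j)) (S i)) & sums_le S B.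
Proof.
move=> f0 fB; have [s hs] := has_sum_nneg_exists f0 fB.
have sec i : exists S : R, has_sum (fun j => rc (f (i, j))) (rc S).
  by apply: (@has_sum_nneg_exists _ (fun j => f (i, j)) B) => //; apply: sums_le_section.
pose S i := sval (cid (sec i)).
have hS i : has_sum (fun j => rc (f (i, j))) (rc (S i)) by rewrite /S; case: (cid _).
have aS i : sums_le (fun j => f (i, j)) (S i) by apply: has_sum_nneg_le (hS i).
exists S => //.
have sB : s <= B.
  have := has_sum_cmod_le (B := B) _ hs; rewrite cmod_real => h.
  apply: le_trans (ler_norm s) _; apply: h; apply: sums_le_trans fB => p.
  by rewrite cmod_real ger0_norm.
have h := has_sum_iter (f := fun p => rc (f p)) hs hS.
have S0 i : 0 <= S i by apply: sums_le_ge0 (aS i).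
by move=> L; apply: le_trans sB; apply: (has_sum_nneg_le S0 h).
Qed.

End Sums.

(** * Multi-indices *)

Section MultiIndex.
Variable N : nat.
Implicit Types al be ga de : multi N.

Definition madd al be : multi N := [ffun i => (al i + be i)%N].
Definition msub al be : multi N := [ffun i => (al i - be i)%N].
Definition mi0 : multi N := [ffun=> 0%N].
Definition munit (j : 'I_N) : multi N := [ffun i => (i == j : nat)].
Definition mle al be := [forall i, (al i <= be i)%N].
Definition mbin al be : nat := (\prod_i 'C(al i, be i))%N.

Lemma maddC al be : madd al be = madd be al.
Proof. by apply/ffunP => i; rewrite !ffunE addnC. Qed.

Lemma madd0 al : madd al mi0 = al.
Proof. by apply/ffunP => i; rewrite !ffunE addn0. Qed.

Lemma madd0l al : madd mi0 al = al.
Proof. by apply/ffunP => i; rewrite !ffunE. Qed.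

Lemma maddA al be ga : madd al (madd be ga) = madd (madd al be) ga.
Proof. by apply/ffunP => i; rewrite !ffunE addnA. Qed.

Lemma msubK al be : mle be al -> madd be (msub al be) = al.
Proof.
by move=> /forallP h; apply/ffunP => i; rewrite !ffunE subnKC.
Qed.

Lemma maddK al be : msub (madd al be) al = be.
Proof. by apply/ffunP => i; rewrite !ffunE addKn. Qed.

Lemma mle_add al be : mle al (madd al be).
Proof. by apply/forallP => i; rewrite !ffunE leq_addr. Qed.

Lemma mabsD al be : mabs (madd al be) = (mabs al + mabs be)%N.
Proof. by rewrite /mabs -big_split; apply: eq_bigr => i _; rewrite ffunE. Qed.

Lemma mabs0 : mabs mi0 = 0%N.
Proof. by rewrite /mabs big1 // => i _; rewrite ffunE. Qed.

Lemma mabs_unit j : mabs (munit j) = 1%N.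
Proof.
rewrite /mabs (bigD1 j) //= ffunE eqxx big1 // => i /negPf h.
by rewrite ffunE h.
Qed.

Lemma mabs_ge al i : (al i <= mabs al)%N.
Proof. by rewrite /mabs (bigD1 i) //= leq_addr. Qed.

Lemma mabs_eq0 al : mabs al = 0%N -> al = mi0.
Proof.
move=> h; apply/ffunP => i; rewrite ffunE; apply/eqP.
by rewrite -leqn0 -h mabs_ge.
Qed.

Definition box k : {fset multi N} :=
  seq_fset tt [seq multi_of_ord f | f <- enum {: {ffun 'I_N -> 'I_k}}].

Lemma multi_of_ord_inj k : injective (@multi_of_ord N k).
Proof.
move=> f g /ffunP h; apply/ffunP => i; apply/val_inj.
by have := h i; rewrite !ffunE.
Qed.

Lemma mem_box k al : (al \in box k) = [forall i, (al i < k)%N].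
Proof.
rewrite seq_fsetE; apply/mapP/forallP => [[f _ ->] i|h].
  by rewrite ffunE.
exists [ffun i => Ordinal (h i)]; first by rewrite mem_enum.
by apply/ffunP => i; rewrite !ffunE.
Qed.

Lemma big_box (V : nmodType) k (F : multi N -> V) :
  \sum_(al <- box k) F al = \sum_(f : {ffun 'I_N -> 'I_k}) F (multi_of_ord f).
Proof.
have E : perm_eq (box k) [seq multi_of_ord f | f <- enum {: {ffun 'I_N -> 'I_k}}].
  apply: uniq_perm => [||al]; first exact: fset_uniq.
    by rewrite map_inj_uniq ?enum_uniq //; apply: multi_of_ord_inj.
  by rewrite seq_fsetE.
by rewrite (perm_big _ E) big_map big_enum.
Qed.

Lemma big_box_prod (V : comNzRingType) k (G : 'I_N -> nat -> V) :
  \sum_(al <- box k) \prod_i G i (al i) = \prod_i \sum_(j < k) G i j.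
Proof.
rewrite big_box bigA_distr_bigA /=; apply: eq_bigr => f _.
by apply: eq_bigr => i _; rewrite ffunE.
Qed.

Lemma sub_box (A : {fset multi N}) : exists k, (A `<=` box k)%fset.
Proof.
exists (\sum_(al <- A) mabs al).+1; apply/fsubsetP => al alA.
rewrite mem_box; apply/forallP => i; rewrite ltnS.
apply: leq_trans (mabs_ge al i) _.
by rewrite (big_fsetD1 _ alA) /= leq_addr.
Qed.

Definition below al : {fset multi N} := [fset be in box (mabs al).+1 | mle be al]%fset.

Lemma mem_below al be : (be \in below al) = mle be al.
Proof.
rewrite !inE /= mem_box; case: (boolP (mle be al)) => [/forallP h|]; rewrite ?andbF //.
rewrite andbT; apply/forallP => i; rewrite ltnS.
exact: leq_trans (h i) (mabs_ge _ _).
Qed.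

Definition pairs al : {fset multi N * multi N} :=
  [fset (be, msub al be) | be in below al]%fset.

Lemma mem_pairs al p : (p \in pairs al) = (madd p.1 p.2 == al).
Proof.
apply/imfsetP/eqP => [[be /=]|h].
  by rewrite mem_below => /msubK h -> /=.
exists p.1; first by rewrite /= mem_below -h mle_add.
by rewrite -h maddK -surjective_pairing.
Qed.

Lemma big_pairs (V : nmodType) al (F : multi N * multi N -> V) :
  \sum_(p <- pairs al) F p = \sum_(be <- below al) F (be, msub al be).
Proof. by rewrite big_imfset //= => ? ? _ _ []. Qed.

Lemma monomD (V : comNzRingType) al be (u : 'rV[V]_N) :
  monom (madd al be) u = monom al u * monom be u.
Proof.
by rewrite /monom -big_split; apply: eq_bigr => i _; rewrite ffunE exprD.
Qed.

Lemma monom0 (V : comNzRingType) (u : 'rV[V]_N) : monom mi0 u = 1.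
Proof. by rewrite /monom big1 // => i _; rewrite ffunE expr0. Qed.

Lemma monom_unit (V : comNzRingType) (u : 'rV[V]_N) j : monom (munit j) u = u 0 j.
Proof.
rewrite /monom (bigD1 j) //= ffunE eqxx big1 ?mulr1 // => i /negPf h.
by rewrite ffunE h expr0.
Qed.

Lemma monom_const (V : comNzRingType) al (a : V) :
  monom al (const_mx a : 'rV[V]_N) = a ^+ mabs al.
Proof.
by rewrite /monom /mabs expr_sum; apply: eq_bigr => i _; rewrite mxE.
Qed.

(** The multinomial form of the binomial theorem, obtained by expanding the
    product over coordinates. The exponents are summed over a common box; indices
    outside the divisors of the monomial contribute vanishing binomials. *)
Lemma monom_binom (V : comNzRingType) al (z u : 'rV[V]_N) :
  monom al (z + u) = \sum_(p <- pairs al)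
     (mbin (madd p.1 p.2) p.1)%:R * monom p.2 z * monom p.1 u.
Proof.
pose k := (mabs al).+1.
have E i : (z 0 i + u 0 i) ^+ al i =
    \sum_(j < k) (z 0 i ^+ (al i - j) * u 0 i ^+ j) *+ 'C(al i, j).
  rewrite exprDn; have lk : ((al i).+1 <= k)%N by rewrite ltnS mabs_ge.
  rewrite (big_ord_widen k (fun j => (z 0 i ^+ (al i - j) * u 0 i ^+ j) *+ 'C(al i, j)) lk).
  rewrite big_mkcond /=; apply: eq_bigr => j _; case: ltnP => // h.
  by rewrite bin_small.
rewrite /monom; under eq_bigr => i _ do rewrite mxE E.
rewrite -(big_box_prod k (fun i j => (z 0 i ^+ (al i - j) * u 0 i ^+ j) *+ 'C(al i, j))).
rewrite big_pairs (@fset_sum_incl _ _ _ (below al) (box k)).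
- rewrite big_seq [RHS]big_seq; apply: eq_bigr => be; rewrite mem_below => h /=.
  rewrite msubK // /mbin natr_prod -!big_split; apply: eq_bigr => i _ /=.
  by rewrite ffunE -mulr_natl mulrA.
- by apply/fsubsetP => be; rewrite !inE /= => /andP[].
move=> be _; rewrite mem_below /mle negb_forall => /existsP[j]; rewrite -ltnNge => h.
by rewrite (bigD1 j) //= bin_small // mulr0n mul0r.
Qed.

End MultiIndex.

(** * Power series with an l1 bound *)

Section Coefficients.
Variables (R : realType) (N : nat).
Local Notation K := (CC R).
Implicit Types (c d : multi N -> K) (al be ga : multi N) (u z : 'rV[K]_N).

Lemma has_sum_pairs al (f : multi N * multi N -> K) :
  has_sum (fun p => if madd p.1 p.2 == al then f p else 0) (\sum_(p <- pairs al) f p).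
Proof.
have -> : \sum_(p <- pairs al) f p =
    \sum_(p <- pairs al) (if madd p.1 p.2 == al then f p else 0).
  by rewrite big_seq [RHS]big_seq; apply: eq_bigr => p; rewrite mem_pairs => ->.
by apply: has_sum_fin => p; rewrite mem_pairs => /negPf ->.
Qed.

Lemma sums_le_pairs al (f : multi N * multi N -> R) :
  (forall p, 0 <= f p) ->
  sums_le (fun p => if madd p.1 p.2 == al then f p else 0) (\sum_(p <- pairs al) f p).
Proof.
move=> f0; have -> : \sum_(p <- pairs al) f p =
    \sum_(p <- pairs al) (if madd p.1 p.2 == al then f p else 0).
  by rewrite big_seq [RHS]big_seq; apply: eq_bigr => p; rewrite mem_pairs => ->.
apply: sums_le_fin => p; first by case: ifP.
by rewrite mem_pairs => /negPf ->.
Qed.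

Definition conv c d al : K := \sum_(p <- pairs al) c p.1 * d p.2.

(** The weighted l1 norm at radius r is submultiplicative under Cauchy products,
    which turns estimates of powers of series into powers of estimates. *)
Definition l1_le c (r B : R) := sums_le (fun al => cmod (c al) * r ^+ mabs al) B.

Lemma cmod_monom_le al u (r : R) :
  (forall i, cmod (u 0 i) <= r) -> cmod (monom al u) <= r ^+ mabs al.
Proof.
move=> h; rewrite /monom cmod_prod /mabs expr_sum.
apply: ler_prod => i _; rewrite cmodX exprn_ge0 ?cmod_ge0 //=.
by apply: lerXn2r; rewrite ?nnegrE ?cmod_ge0 // (le_trans (cmod_ge0 _) (h i)).
Qed.

Lemma l1_le_sums c r B u : l1_le c r B -> (forall i, cmod (u 0 i) <= r) ->
  sums_le (fun al => cmod (c al * monom al u)) B.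
Proof.
move=> cB h; apply: sums_le_trans cB => al; rewrite cmodM ler_wpM2l ?cmod_ge0 //.
exact: cmod_monom_le.
Qed.

Lemma l1_le_trans c r B r' B' : 0 <= r' -> r' <= r -> B <= B' ->
  l1_le c r B -> l1_le c r' B'.
Proof.
move=> r0 rr BB h L; apply: le_trans BB; apply: le_trans (h L); apply: ler_sum => al _.
rewrite ler_wpM2l ?cmod_ge0 // lerXn2r ?nnegrE //; exact: le_trans rr.
Qed.

Lemma l1_le_conv c d r A B : 0 <= r ->
  l1_le c r A -> l1_le d r B -> l1_le (conv c d) r (A * B).
Proof.
move=> r0 cA dB.
have p0 e al : 0 <= cmod (e al : K) * r ^+ mabs al.
  by rewrite mulr_ge0 ?cmod_ge0 ?exprn_ge0.
have h := sums_le_prod (p0 c) (p0 d) cA dB.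
have h2 : sums_le (fun al => \sum_(p <- pairs al)
    (cmod (c p.1) * r ^+ mabs p.1 * (cmod (d p.2) * r ^+ mabs p.2))) (A * B).
  apply: (sums_le_push (h := fun p => madd p.1 p.2) _ _ h) => [p|al p].
    by rewrite mulr_ge0.
  by rewrite mem_pairs => /eqP.
apply: sums_le_trans h2 => al.
apply: le_trans (_ : \sum_(p <- pairs al) cmod (c p.1 * d p.2) * r ^+ mabs al <= _).
  by rewrite -mulr_suml ler_wpM2r ?exprn_ge0 // cmod_sum.
rewrite big_seq [leRHS]big_seq; apply: ler_sum => p.
rewrite mem_pairs => /eqP <-; rewrite mabsD exprD cmodM.
by rewrite mulrACA.
Qed.

Lemma l1_leD c d r A B : 0 <= r ->
  l1_le c r A -> l1_le d r B -> l1_le (fun al => c al + d al) r (A + B).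
Proof.
move=> r0 cA dB.
apply: sums_le_trans (sums_leD cA dB) => al; rewrite -mulrDl ler_wpM2r ?exprn_ge0 //.
exact: cmodD.
Qed.

Lemma l1_leZ a c r B : l1_le c r B -> l1_le (fun al => a * c al) r (cmod a * B).
Proof.
move=> cB; apply: sums_le_trans (sums_leZ (cmod_ge0 a) cB) => al.
by rewrite cmodM mulrA.
Qed.

(** The product of N geometric series of ratio 1/2, each at most 2. *)
Lemma geom_box (k : nat) : \sum_(al <- box N k) (2^-1 : R) ^+ mabs al <= 2 ^+ N.
Proof.
under eq_bigr => al _ do rewrite /mabs expr_sum.
rewrite (big_box_prod k (fun _ j => (2^-1 : R) ^+ j)).
rewrite -[leRHS](_ : \prod_(i < N) (2 : R) = _); last by rewrite prodr_const card_ord.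
apply: ler_prod => i _; rewrite sumr_ge0 /=; last by move=> j _; rewrite exprn_ge0 ?invr_ge0.
have -> : \sum_(j < k) (2^-1 : R) ^+ j = 2 - 2 * 2^-1 ^+ k.
  elim: k => [|k IH]; first by rewrite big_ord0 expr0; ring.
  by rewrite big_ord_recr /= IH exprS; field.
by rewrite lerBlDr lerDl mulr_ge0 ?exprn_ge0 ?invr_ge0.
Qed.

(** Halving the radius turns a bound on each coefficient (Cauchy estimate) into
    an l1 bound. *)
Lemma l1_le_geom c r B : 0 <= r -> (forall al, cmod (c al) * r ^+ mabs al <= B) ->
  l1_le c (r / 2) (B * 2 ^+ N).
Proof.
move=> r0 h L; have [k Lk] := sub_box L.
have B0 : 0 <= B by apply: le_trans (h (mi0 N)); rewrite mulr_ge0 ?cmod_ge0 ?exprn_ge0.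
apply: (le_trans (y := \sum_(al <- L) B * 2^-1 ^+ mabs al)).
  apply: ler_sum => al _; rewrite exprMn mulrA ler_wpM2r ?exprn_ge0 ?invr_ge0 //.
rewrite -mulr_sumr ler_wpM2l //; apply: le_trans (geom_box k).
by apply: fset_sum_le => // al; rewrite exprn_ge0 ?invr_ge0.
Qed.

(** Absolute convergence is part of the definition, with an explicit radius and
    bound, so that neighbouring expansions come with the same data. *)
Definition expands (f : 'rV[K]_N -> K) (a : 'rV[K]_N) c (r B : R) :=
  l1_le c r B /\ forall u, (forall i, cmod (u 0 i) <= r) ->
    has_sum (fun al => c al * monom al u) (f (a + u)).

Lemma expandsM f g a c d r A B : 0 <= r ->
  expands f a c r A -> expands g a d r B ->
  expands (fun w => f w * g w) a (conv c d) r (A * B).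
Proof.
move=> r0 [cA fc] [dB gd]; split; first exact: l1_le_conv.
move=> u hu; have := has_sum_prod (l1_le_sums cA hu) (l1_le_sums dB hu) (fc u hu) (gd u hu).
move=> h; apply: (has_sum_fibres (h := fun p => madd p.1 p.2) h) => al.
rewrite /conv mulr_suml.
have -> : \sum_(p <- pairs al) c p.1 * d p.2 * monom al u =
    \sum_(p <- pairs al) c p.1 * monom p.1 u * (d p.2 * monom p.2 u).
  rewrite big_seq [RHS]big_seq; apply: eq_bigr => p; rewrite mem_pairs => /eqP <-.
  by rewrite monomD; ring.
exact: has_sum_pairs.
Qed.

Lemma expandsD f g a c d r A B : 0 <= r ->
  expands f a c r A -> expands g a d r B ->
  expands (fun w => f w + g w) a (fun al => c al + d al) r (A + B).
Proof.
move=> r0 [cA fc] [dB gd]; split; first exact: l1_leD.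
move=> u hu; apply: eq_has_sum (has_sumD (fc u hu) (gd u hu)) => al.
by rewrite mulrDl.
Qed.

Lemma expandsZ f a c r B k :
  expands f a c r B -> expands (fun w => k * f w) a (fun al => k * c al) r (cmod k * B).
Proof.
move=> [cB fc]; split; first exact: l1_leZ.
by move=> u hu; apply: eq_has_sum (has_sumZ k (fc u hu)) => al; rewrite mulrA.
Qed.

Lemma expands_le f a c r B r' B' : 0 <= r' -> r' <= r -> B <= B' ->
  expands f a c r B -> expands f a c r' B'.
Proof.
move=> r0 rr BB [h1 h2]; split; first exact: l1_le_trans h1.
by move=> u hu; apply: h2 => i; apply: le_trans rr.
Qed.

(** Coefficients of the divided derivative of index ga of the series c. *)
Definition hasse c ga al : K := (mbin (madd ga al) ga)%:R * c (madd ga al).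

(** The coefficients of the series c re-expanded around the displaced centre z. *)
Definition recentre c z ga : K :=
  xget 0 [set s | has_sum (fun al => hasse c ga al * monom al z) s].

(** The double family behind re-centring, grouped by ga + al, is majorised by
    |c| at radius r/2 + r/2 = r, by the binomial theorem. This is why half of the
    radius survives and the bound B does not change. *)
Lemma double_sums_le c r B : 0 <= r -> l1_le c r B ->
  sums_le (fun p : multi N * multi N =>
    cmod (hasse c p.1 p.2) * (r / 2) ^+ mabs p.2 * (r / 2) ^+ mabs p.1) B.
Proof.
move=> r0 cB; have r20 : 0 <= r / 2 by rewrite divr_ge0.
have f0 : forall p : multi N * multi N,
    0 <= cmod (hasse c p.1 p.2) * (r / 2) ^+ mabs p.2 * (r / 2) ^+ mabs p.1.
  by move=> p; rewrite !mulr_ge0 ?cmod_ge0 ?exprn_ge0.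
apply: (sums_le_fibres (h := fun p => madd p.1 p.2) f0 _ cB) => al.
have := sums_le_pairs al f0; congr sums_le.
have {3}-> : r = r / 2 + r / 2 by lra.
rewrite -(monom_const al (r / 2 + r / 2)).
have -> : const_mx (r / 2 + r / 2) = const_mx (r / 2) + const_mx (r / 2) :> 'rV_N.
  by apply/rowP => i; rewrite !mxE.
rewrite monom_binom mulr_sumr big_seq [RHS]big_seq; apply: eq_bigr => p.
rewrite mem_pairs => /eqP E; rewrite /hasse !monom_const cmodM cmod_nat E; ring.
Qed.

Lemma recentre_l1_le c r B ga : 0 < r -> l1_le c r B ->
  l1_le (hasse c ga) (r / 2) (B / (r / 2) ^+ mabs ga).
Proof.
move=> r0 cB; have r20 : 0 < r / 2 by lra.
move=> L; rewrite ler_pdivlMr ?exprn_gt0 // mulr_suml.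
apply: (sums_le_section ga _ (double_sums_le (ltW r0) cB)).
by move=> p; rewrite !mulr_ge0 ?cmod_ge0 ?exprn_ge0 // ltW.
Qed.

Lemma recentreP c r B ga z : 0 < r -> l1_le c r B -> (forall i, cmod (z 0 i) <= r / 2) ->
  has_sum (fun al => hasse c ga al * monom al z) (recentre c z ga).
Proof.
move=> r0 cB hz; have h := recentre_l1_le ga r0 cB.
have [s hs] := has_sum_exists (l1_le_sums h hz).
rewrite /recentre.
by apply: (@xgetI _ 0 [set s | has_sum (fun al => hasse c ga al * monom al z) s] s).
Qed.

(** A Taylor coefficient of index ga is itself a power series in the base point. *)
Lemma recentre_expands c r B ga a : 0 < r -> l1_le c r B ->
  expands (fun w => recentre c (w - a) ga) a (hasse c ga) (r / 2)
          (B / (r / 2) ^+ mabs ga).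
Proof.
move=> r0 cB; split; first exact: recentre_l1_le.
by move=> u hu; rewrite addrC addKr; apply: recentreP hu.
Qed.

(** Both sides are sums of the double family
    c_(ga+al) binom(ga+al, ga) z^al u^ga, grouped by ga + al and by ga. *)
Lemma reexpand f a c r B z : 0 < r -> expands f a c r B ->
  (forall i, cmod (z 0 i) <= r / 2) -> expands f (a + z) (recentre c z) (r / 2) B.
Proof.
move=> r0 [cB fc] hz; have r20 : 0 <= r / 2 by lra.
have dB := double_sums_le (ltW r0) cB; split.
  have [|S hS SB] := sums_le_iter _ dB.
    by move=> p; rewrite !mulr_ge0 ?cmod_ge0 ?exprn_ge0.
  apply: sums_le_trans SB => ga.
  have /has_sum_cmod_le bd := recentreP ga r0 cB hz.
  move: (hS ga) => /= hSg.
  have [g0|g0] := eqVneq ((r / 2) ^+ mabs ga) 0.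
    by rewrite g0 mulr0; apply: sums_le_ge0 hSg.
  have gp : 0 < (r / 2) ^+ mabs ga by rewrite lt_neqAle eq_sym g0 exprn_ge0.
  rewrite -ler_pdivlMr //; apply: bd => L.
  rewrite ler_pdivlMr // mulr_suml; apply: le_trans (hSg L).
  apply: ler_sum => al _; rewrite ler_wpM2r ?(ltW gp) // cmodM ler_wpM2l ?cmod_ge0 //.
  exact: cmod_monom_le.
move=> u hu.
pose T (p : multi N * multi N) := hasse c p.1 p.2 * monom p.2 z * monom p.1 u.
have TB : sums_le (fun p => cmod (T p)) B.
  apply: sums_le_trans dB => p; rewrite /T !cmodM.
  by rewrite !ler_pM ?mulr_ge0 ?cmod_ge0 ?cmod_monom_le.
have [s hs] := has_sum_exists TB.
have hzu : forall i, cmod ((z + u) 0 i) <= r.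
  move=> i; rewrite mxE; have := cmodD (z 0 i) (u 0 i).
  by have := hz i; have := hu i; lra.
have E : s = f (a + z + u).
  rewrite -addrA; have := fc _ hzu; apply: has_sum_unique.
  apply: (has_sum_fibres (h := fun p => madd p.1 p.2) hs) => al.
  rewrite monom_binom mulr_sumr.
  rewrite (_ : \sum_(p <- pairs al) _ = \sum_(p <- pairs al) T p); first exact: has_sum_pairs.
  rewrite big_seq [RHS]big_seq; apply: eq_bigr => p.
  by rewrite mem_pairs => /eqP <-; rewrite /T /hasse; ring.
rewrite -E; apply: (has_sum_iter hs) => ga.
rewrite mulrC; apply: eq_has_sum (has_sumZ (monom ga u) (recentreP ga r0 cB hz)) => al.
by rewrite /T; ring.
Qed.

End Coefficients.

(** * Analytic functions *)

#[local] Existing Instance summability.totally_filter.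

Section Bridge.
Variable R : realType.
Local Notation K := (CC R).

Lemma CC_gt0 (e : K) : 0 < e -> exists2 d : R, 0 < d & e = rc d.
Proof.
case: e => a b; rewrite ltcE /= => /andP[/eqP -> a0]; exists a => //.
Qed.

Lemma rc_lt (x y : R) : (rc x < rc y) = (x < y).
Proof. exact: ltcR. Qed.

Lemma rc_le (x y : R) : (rc x <= rc y) = (x <= y).
Proof. exact: lecR. Qed.

Lemma partial_sumE (I : choiceType) (f : I -> K) (J : {fset I}) :
  summability.partial_sum f J = \sum_(i <- J) f i.
Proof. by rewrite /summability.partial_sum big_seq_fsetE. Qed.

Lemma has_sumP (I : choiceType) (f : I -> K) s :
  has_sum f s <-> (summability.partial_sum f @ summability.totally --> s).
Proof.
split=> [fs|/cvgrPdist_lt fs e e0].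
  apply/cvgrPdist_lt => e /CC_gt0[d d0 ->].
  have [J0 h] := fs _ d0; exists J0 => // J /= /h {}h.
  by rewrite partial_sumE distrC cmodE rc_lt.
have [|J0 _ h] := fs (rc e); first by rewrite rc_lt.
exists J0 => J /h /=; by rewrite partial_sumE distrC cmodE rc_lt.
Qed.

Definition polydisc N (x : 'rV[K]_N) (r : R) : set 'rV[K]_N :=
  [set y | forall i, cmod (y 0 i - x 0 i) <= r].

Lemma nbhs_polydisc N (x : 'rV[K]_N) (A : set 'rV[K]_N) :
  nbhs x A -> exists2 r : R, 0 < r & polydisc x r `<=` A.
Proof.
move=> /nbhs_ballP[e /= /CC_gt0[d d0 ->] h]; exists (d / 2); first lra.
move=> y hy; apply: h; split=> [|i j]; rewrite ?rc_lt // (ord1 i) /ball /= distrC cmodE rc_lt.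
by have := hy j; lra.
Qed.

Lemma polydisc_nbhs N (x : 'rV[K]_N) (r : R) : 0 < r -> nbhs x (polydisc x r).
Proof.
move=> r0; apply/nbhs_ballP; exists (rc r); first by rewrite /= rc_lt.
move=> y [_ h] i; have := h 0 i; rewrite /ball /= distrC cmodE rc_lt.
exact: ltW.
Qed.

Lemma polydisc_add N (x u : 'rV[K]_N) (r : R) :
  (forall i, cmod (u 0 i) <= r) <-> polydisc x r (x + u).
Proof. by split=> h i; have := h i; rewrite mxE addrAC subrr add0r. Qed.

End Bridge.

Section Analytic.
Variables (R : realType) (N : nat).
Local Notation K := (CC R).
Implicit Types (f g : 'rV[K]_N -> K) (a u w z : 'rV[K]_N) (c d : multi N -> K).

Definition analytic f a := exists c r B, 0 < r /\ expands f a c r B.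

(** Convergence at the point (r/2, ..., r/2) bounds each term there, since a term
    is the difference of two partial sums; the bound of one point controls a
    polydisc of half its radius. *)
Lemma holomorphic_analytic f a : holomorphic_at f a -> analytic f a.
Proof.
move=> [c [r [r0 h]]].
have hs u : (forall i, cmod (u 0 i) < r) -> has_sum (fun al => c al * monom al u) (f (a + u)).
  move=> hu; apply/has_sumP; apply: h => i; rewrite cmodE -[r%:C]/(rc r) rc_lt; exact: hu.
pose u0 : 'rV[K]_N := const_mx (rc (r / 2)).
have [|J0 hJ] := hs u0 _ 1 ltr01.
  by move=> i; rewrite mxE cmod_real gtr0_norm; lra.
pose t al := c al * monom al u0.
pose B := 2 + \sum_(al <- J0) cmod (t al).
have S0 : 0 <= \sum_(al <- J0) cmod (t al) by rewrite sumr_ge0 // => *; apply: cmod_ge0.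
have hB al : cmod (t al) <= B.
  have [hal|hal] := boolP (al \in J0).
    rewrite /B (big_fsetD1 _ hal) /= addrCA lerDl addr_ge0 // sumr_ge0 // => *.
    exact: cmod_ge0.
  have h1 := hJ _ (fsubset_refl J0).
  have h2 := hJ _ (fsubsetUr [fset al]%fset J0).
  move: h2; rewrite big_fsetU1 //= -/(t al) => h2.
  have -> : t al = (t al + \sum_(i <- J0) t i - f (a + u0)) -
                   (\sum_(i <- J0) t i - f (a + u0)) by ring.
  rewrite /B; apply: (le_trans (cmodB _ _)); rewrite -/t in h1 h2; lra.
have wB : l1_le c (r / 2 / 2) (B * 2 ^+ N).
  apply: l1_le_geom => [|al]; first lra.
  apply: le_trans (hB al); rewrite /t /u0 monom_const cmodM cmodX cmod_real.
  by rewrite gtr0_norm //; lra.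
exists c, (r / 2 / 2), (B * 2 ^+ N); split; first lra.
by split=> // u hu; apply: hs => i; have := hu i; lra.
Qed.

Lemma analytic_holomorphic f a : analytic f a -> holomorphic_at f a.
Proof.
move=> [c [r [B [r0 [cB h]]]]]; exists c, r; split=> // u hu.
apply/has_sumP; apply: h => i; apply: ltW; have := hu i.
by rewrite cmodE -[r%:C]/(rc r) rc_lt.
Qed.

Lemma has_sum_single (I : choiceType) (i0 : I) (x : K) :
  has_sum (fun i => if i == i0 then x else 0) x.
Proof.
rewrite [in X in has_sum _ X](_ : x = \sum_(i <- [fset i0]%fset) (if i == i0 then x else 0)).
  by apply: has_sum_fin => i; rewrite inE => /negPf ->.
by rewrite big_seq_fset1 eqxx.
Qed.

Lemma expands_at f a c r B : 0 <= r -> expands f a c r B -> f a = c (mi0 N).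
Proof.
move=> r0 [_ h]; have := h 0; rewrite addr0 => h0.
have {}h0 := h0 (fun i => _); apply: has_sum_unique (h0 _) _.
  by move=> i; rewrite mxE cmod0.
apply: eq_has_sum (has_sum_single (mi0 N) (c (mi0 N))) => al.
have [->|al0] := eqVneq al (mi0 N); first by rewrite monom0 mulr1.
have [j hj] : exists j, al j != 0%N.
  apply/existsP; rewrite -negb_forall; apply: contra al0 => /forallP h1.
  by apply/eqP/ffunP => j; rewrite ffunE; apply/eqP.
by rewrite /monom (bigD1 j) //= mxE expr0n (negPf hj) mul0r mulr0.
Qed.

Lemma expands_eq f g a c r B : 0 <= r -> (forall w, polydisc a r w -> f w = g w) ->
  expands f a c r B -> expands g a c r B.
Proof.
move=> r0 fg [h1 h2]; split=> // u hu; rewrite -fg ?(polydisc_add a u r).1 //.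
  exact: h2.
exact/polydisc_add.
Qed.

Lemma analytic_eq f g a (r : R) : 0 < r -> (forall w, polydisc a r w -> f w = g w) ->
  analytic f a -> analytic g a.
Proof.
move=> r0 fg [c [r' [B [r'0 h]]]].
have m0 : 0 < Num.min r r' by rewrite lt_min r0.
exists c, (Num.min r r'), B; split=> //.
have h' : expands f a c (Num.min r r') B.
  by apply: expands_le h; rewrite ?(ltW m0) // ge_min lexx orbT.
apply: expands_eq h'; first exact: ltW.
by move=> w hw; apply: fg => i; apply: le_trans (hw i) _; rewrite ge_min lexx.
Qed.

Lemma l1_le_single (ga : multi N) (k : K) (r : R) : 0 <= r ->
  l1_le (fun al => if al == ga then k else 0) r (cmod k * r ^+ mabs ga).
Proof.
move=> r0; rewrite /l1_le.
rewrite [X in sums_le _ X](_ : _ = \sum_(al <- [fset ga]%fset)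
    cmod (if al == ga then k else 0) * r ^+ mabs al); last by rewrite big_seq_fset1 eqxx.
apply: sums_le_fin => al; first by rewrite mulr_ge0 ?cmod_ge0 ?exprn_ge0.
by rewrite inE => /negPf ->; rewrite cmod0 mul0r.
Qed.

Lemma expands_monom k ga a (r : R) : 0 <= r ->
  expands (fun w => k * monom ga (w - a)) a
    (fun al => if al == ga then k else 0) r (cmod k * r ^+ mabs ga).
Proof.
move=> r0; split=> [|u _]; first exact: l1_le_single.
rewrite addrC addKr; apply: eq_has_sum (has_sum_single ga (k * monom ga u)) => al.
by case: eqP => [->|]; rewrite ?mul0r.
Qed.

Lemma analytic_cst k a : analytic (fun _ => k) a.
Proof.
have := expands_monom k (mi0 N) a ler01 => h.
exists (fun al => if al == mi0 N then k else 0), 1, (cmod k * 1 ^+ mabs (mi0 N)).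
split=> //; apply: expands_eq h; first exact: ler01.
by move=> w _; rewrite monom0 mulr1.
Qed.

Lemma analytic2 f g a : analytic f a -> analytic g a ->
  exists c d r A B, [/\ 0 < r, expands f a c r A & expands g a d r B].
Proof.
move=> [c [r [A [r0 h1]]]] [d [r' [B [r'0 h2]]]].
have m0 : 0 < Num.min r r' by rewrite lt_min r0.
exists c, d, (Num.min r r'), A, B; split=> //.
  by apply: expands_le h1; rewrite ?(ltW m0) // ge_min lexx.
by apply: expands_le h2; rewrite ?(ltW m0) // ge_min lexx orbT.
Qed.

Lemma analyticD f g a : analytic f a -> analytic g a -> analytic (fun w => f w + g w) a.
Proof.
move=> /analytic2 h /h[c [d [r [A [B [r0 h1 h2]]]]]].
by do 3! eexists; split; first exact: r0; apply: expandsD; rewrite ?ltW; eauto.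
Qed.

Lemma analyticM f g a : analytic f a -> analytic g a -> analytic (fun w => f w * g w) a.
Proof.
move=> /analytic2 h /h[c [d [r [A [B [r0 h1 h2]]]]]].
by do 3! eexists; split; first exact: r0; apply: expandsM; rewrite ?ltW; eauto.
Qed.

Lemma analytic_coord i a : analytic (fun w => w 0 i) a.
Proof.
have h : analytic (fun w => 1 * monom (munit i) (w - a)) a.
  do 3! eexists; split; first exact: ltr01.
  exact: expands_monom ler01.
have := analyticD h (analytic_cst (a 0 i) a).
by apply: (analytic_eq ltr01) => w _; rewrite monom_unit !mxE mul1r subrK.
Qed.

Lemma analyticZ k f a : analytic f a -> analytic (fun w => k * f w) a.
Proof. by move=> h; apply: analyticM => //; apply: analytic_cst. Qed.

Lemma analyticN f a : analytic f a -> analytic (fun w => - f w) a.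
Proof.
by move=> /(analyticZ (-1)); apply: (analytic_eq ltr01) => w _; rewrite mulN1r.
Qed.

Lemma analytic_sum (T : Type) (s : seq T) (F : T -> 'rV[K]_N -> K) a :
  (forall t, analytic (F t) a) -> analytic (fun w => \sum_(t <- s) F t w) a.
Proof.
move=> h; elim: s => [|t s IH].
  by apply: (analytic_eq ltr01) (analytic_cst 0 a) => w _; rewrite big_nil.
by apply: (analytic_eq ltr01) (analyticD (h t) IH) => w _; rewrite big_cons.
Qed.

Lemma analytic_prod (T : Type) (s : seq T) (F : T -> 'rV[K]_N -> K) a :
  (forall t, analytic (F t) a) -> analytic (fun w => \prod_(t <- s) F t w) a.
Proof.
move=> h; elim: s => [|t s IH].
  by apply: (analytic_eq ltr01) (analytic_cst 1 a) => w _; rewrite big_nil.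
by apply: (analytic_eq ltr01) (analyticM (h t) IH) => w _; rewrite big_cons.
Qed.

Lemma analyticX f k a : analytic f a -> analytic (fun w => f w ^+ k) a.
Proof.
move=> h; elim: k => [|k IH].
  by apply: (analytic_eq ltr01) (analytic_cst 1 a) => w _; rewrite expr0.
by apply: (analytic_eq ltr01) (analyticM h IH) => w _; rewrite exprS.
Qed.

Lemma analytic_det m (F : 'I_m -> 'I_m -> 'rV[K]_N -> K) a :
  (forall i j, analytic (F i j) a) ->
  analytic (fun w => \det (\matrix_(i, j) F i j w)) a.
Proof.
move=> h; apply: analytic_sum => s; apply: analyticM; first exact: analytic_cst.
have := analytic_prod (index_enum 'I_m) (fun i => h i (s i)).
by apply: (analytic_eq ltr01) => w _; apply: eq_bigr => i _; rewrite mxE.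
Qed.

Lemma mabs_lt2 al : (mabs al < 2)%N -> al = mi0 N \/ exists i : 'I_N, al = munit i.
Proof.
case E : (mabs al) => [|[|//]] _; first by left; apply: mabs_eq0.
right; have [i hi] : exists i, al i != 0%N.
  apply/existsP; rewrite -negb_forall; apply/negP => /forallP h0.
  by move: E; rewrite /mabs big1 // => i _; apply/eqP.
exists i; rewrite (_ : al = madd (munit i) (msub al (munit i))).
  rewrite [msub _ _](@mabs_eq0 N) ?madd0 //; apply/eqP.
  have le1 : mle (munit i) al.
    by apply/forallP => j; rewrite ffunE; case: eqP => // ->; rewrite lt0n.
  by move: E; rewrite -{1}(msubK le1) mabsD mabs_unit add1n => -[->].
rewrite msubK //; apply/forallP => j; rewrite ffunE; case: eqP => // ->.
by rewrite lt0n.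
Qed.

(** The terms of degree at least 2 are dominated by (|t|/d)^2 times the l1 bound
    at radius r. *)
Lemma expands_slope f a c r B v : 0 < r -> expands f a c r B ->
  exists C d : R, [/\ 0 < d, 0 <= C & forall t : R, `|t| <= d ->
    cmod (f (a + rc t *: v) - f a - rc t * \sum_i c (munit i) * v 0 i) <= C * t ^+ 2].
Proof.
move=> r0 hf; have fa := expands_at (ltW r0) hf; case: hf => cB hf.
pose V := 1 + \sum_i cmod (v 0 i).
have V1 : 1 <= V by rewrite lerDl sumr_ge0 // => *; apply: cmod_ge0.
have V0 : 0 < V by lra.
have hV i : cmod (v 0 i) <= V.
  rewrite /V (bigD1 i) //= addrCA lerDl addr_ge0 // sumr_ge0 // => *.
  exact: cmod_ge0.
pose d := r / V; have d0 : 0 < d by rewrite divr_gt0.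
exists (B / d ^+ 2), d; split=> //.
  by rewrite divr_ge0 ?exprn_ge0 ?(sums_le_ge0 cB) ?ltW.
move=> t td.
pose u := rc t *: v.
have hu i : cmod (u 0 i) <= `|t| * V.
  by rewrite mxE cmodM cmod_real ler_wpM2l.
have tV : `|t| * V <= r by rewrite -ler_pdivlMr.
have hu' i : cmod (u 0 i) <= r by apply: le_trans (hu i) tV.
(* The part of degree at most 1 of the series, as a finitely supported family. *)
pose g al := (if al == mi0 N then c (mi0 N) else 0) +
   \sum_(i <- index_enum 'I_N) (if al == munit i then c (munit i) * u 0 i else 0).
have hg : has_sum g (c (mi0 N) + \sum_i c (munit i) * u 0 i).
  apply: has_sumD; first exact: has_sum_single.
  apply: has_sum_sum => i; exact: has_sum_single.
have hs := has_sumD (hf u hu') (has_sumZ (-1) hg).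
rewrite [X in cmod X](_ : _ = f (a + u) +
  -1 * (c (mi0 N) + \sum_i c (munit i) * u 0 i)); last first.
  rewrite fa mulN1r opprD addrA; congr (_ - _ - _).
  by rewrite mulr_sumr; apply: eq_bigr => i _; rewrite mxE mulrCA.
apply: has_sum_cmod_le hs.
have -> : B / d ^+ 2 * t ^+ 2 = (`|t| / d) ^+ 2 * B.
  by rewrite (expr_div_n `|t|) real_normK ?num_real //; ring.
have := sums_leZ (sqr_ge0 (`|t| / d)) cB; apply: sums_le_trans => al.
have rhs0 : 0 <= (`|t| / d) ^+ 2 * (cmod (c al) * r ^+ mabs al).
  apply: mulr_ge0; first exact: sqr_ge0.
  by apply: mulr_ge0; rewrite ?cmod_ge0 ?exprn_ge0 ?(ltW r0).
have unit_ne i : (munit i == mi0 N) = false.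
  by apply/negP => /eqP /(congr1 (@mabs N)); rewrite mabs_unit mabs0.
have [al2|al2] := ltnP (mabs al) 2.
  suff -> : c al * monom al u + -1 * g al = 0 by rewrite cmod0.
  rewrite /g; have [->|[i ->]] := mabs_lt2 al2.
    rewrite eqxx monom0 big1 => [|i _]; first by ring.
    by rewrite eq_sym unit_ne.
  rewrite unit_ne add0r (bigD1 i) //= eqxx big1 => [|j ji].
    by rewrite addr0 monom_unit; ring.
  case: eqP => // /ffunP /(_ i); rewrite !ffunE eqxx.
  by rewrite eq_sym (negPf ji).
have -> : g al = 0.
  rewrite /g; case: eqP => [E|_]; first by rewrite E mabs0 in al2.
  rewrite add0r big1 // => i _; case: eqP => // E.
  by rewrite E mabs_unit in al2.
rewrite mulr0 addr0 cmodM mulrCA ler_wpM2l ?cmod_ge0 //.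
apply: le_trans (cmod_monom_le _ hu) _.
have -> : `|t| * V = (`|t| / d) * r by rewrite /d; field; rewrite !gt_eqF.
rewrite exprMn; apply: ler_wpM2r; first by rewrite exprn_ge0 // ltW.
have x0 : 0 <= `|t| / d by rewrite divr_ge0 // ltW.
rewrite -(subnK al2) exprD; apply: ler_piMl; first exact: exprn_ge0.
by apply: exprn_ile1; rewrite // ler_pdivrMr // mul1r.
Qed.

End Analytic.

(** * Wirtinger derivatives of power series in u and its conjugate *)

Section RealDerivative.
Variable R : realType.
Local Notation K := (CC R).

(** A quadratic remainder makes the difference quotients converge, at the rate |t|. *)
Lemma derive1_taylor (h : R -> R) (l C d : R) : 0 < d -> 0 <= C ->
  (forall t, `|t| <= d -> `|h t - h 0 - t * l| <= C * t ^+ 2) -> derive1 h 0 = l.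
Proof.
move=> d0 C0 H; rewrite /derive1; apply: cvg_lim => //.
apply/cvgrPdist_lt => e e0.
pose e1 := Num.min d (e / (C + 1)).
have C1 : 0 < C + 1 by lra.
have e10 : 0 < e1 by rewrite lt_min d0 divr_gt0.
near=> t.
have t0 : t != 0 by near: t; apply: nbhs_dnbhs_neq.
have te : `|t| < e1 by near: t; apply: dnbhs0_lt.
have td : `|t| <= d by apply: ltW (lt_le_trans te _); rewrite ge_min lexx.
have te' : `|t| * (C + 1) < e.
  by rewrite -ltr_pdivlMr //; apply: lt_le_trans te _; rewrite ge_min lexx orbT.
have tp : 0 < `|t| by rewrite normr_gt0.
have := H t td; rewrite addr0 => Ht.
have -> : l - t^-1 *: (h t - h 0) = - (t^-1 * (h t - h 0 - t * l)).
  by rewrite /GRing.scale /=; field.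
rewrite normrN normrM normfV ltr_pdivrMl //.
have tt : t ^+ 2 = `|t| * `|t| by rewrite -expr2 real_normK ?num_real.
rewrite tt in Ht; nra.
Unshelve. all: by end_near.
Qed.

Lemma derive1_path (g : R -> K) (l : K) (C d : R) : 0 < d -> 0 <= C ->
  (forall t, `|t| <= d -> cmod (g t - g 0 - rc t * l) <= C * t ^+ 2) ->
  derive1 (fun t => complex.Re (g t)) 0 +i* derive1 (fun t => complex.Im (g t)) 0
    = l :> K.
Proof.
move=> d0 C0 H.
rewrite (@derive1_taylor _ (complex.Re l) C d) //; last first.
  move=> t /H; apply: le_trans; apply: le_trans (cmod_Re _).
  case: (g t) => a b; case: (g 0) => a' b'; case: (l) => x y /=.
  by rewrite !mul0r subr0.
rewrite (@derive1_taylor _ (complex.Im l) C d) //; last first.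
  move=> t /H; apply: le_trans; apply: le_trans (cmod_Im _).
  case: (g t) => a b; case: (g 0) => a' b'; case: (l) => x y /=.
  by rewrite mul0r addr0.
by case: l {H}.
Qed.

End RealDerivative.

Section Wirtinger.
Variables (R : realType) (n : nat).
Local Notation K := (CC R).
Implicit Types (F G : 'rV[K]_n -> K) (c d : multi (n + n) -> K) (u v x : 'rV[K]_n).

Lemma conjvD u v : conjv (u + v) = conjv u + conjv v.
Proof. by apply/rowP => i; rewrite !mxE rmorphD. Qed.

Lemma diagD u v : diag (u + v) = diag u + diag v.
Proof. by rewrite /diag conjvD -add_row_mx. Qed.

Lemma diagZ (t : R) v : diag (rc t *: v) = rc t *: diag v.
Proof.
rewrite /diag scale_row_mx; congr row_mx; apply/rowP => i; rewrite !mxE.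
by rewrite rmorphM /= oppr0.
Qed.

Lemma diag0 : diag (0 : 'rV[K]_n) = 0.
Proof.
apply/rowP => i; rewrite !mxE; case: (fintype.split i) => j; rewrite !mxE //.
by rewrite conjc0.
Qed.

Lemma cmod_diag u (r : R) : (forall i, cmod (u 0 i) <= r) -> forall i, cmod (diag u 0 i) <= r.
Proof.
move=> h i; rewrite mxE; case: (fintype.split i) => j; rewrite ?mxE //.
by rewrite cmod_conj.
Qed.

Lemma diag_l u i : diag u 0 (lshift n i) = u 0 i.
Proof. by rewrite /diag row_mxEl. Qed.

Lemma diag_r u i : diag u 0 (rshift n i) = conjc (u 0 i).
Proof. by rewrite /diag row_mxEr mxE. Qed.

(** Near 0, F is a power series in u and conj u with coefficients c: it is the
    restriction to the diagonal of a function Ft expanded on C^n x C^n. *)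
Definition dexpands F c := exists Ft (r B : R), [/\ 0 < r, expands Ft 0 c r B &
  forall u, (forall i, cmod (u 0 i) <= r) -> F u = Ft (diag u)].

Lemma dirder_expands F (Ft : 'rV[K]_(n + n) -> K) c u v (r B d : R) :
  0 < r -> 0 < d -> expands Ft (diag u) c r B ->
  (forall t : R, `|t| <= d -> F (u + rc t *: v) = Ft (diag u + rc t *: diag v)) ->
  dirder v F u = \sum_i c (munit i) * diag v 0 i.
Proof.
move=> r0 d0 h hF; have [C [d' [d'0 C0 H]]] := expands_slope (diag v) r0 h.
have m0 : 0 < Num.min d d' by rewrite lt_min d0.
rewrite /dirder; apply: (@derive1_path _ (fun t => F (u + rc t *: v)) _ C _ m0 C0).
move=> t; rewrite le_min => /andP[td td'].
have h0 : F (u + rc 0 *: v) = Ft (diag u).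
  by rewrite hF ?normr0 ?(ltW d0) // [rc 0](_ : _ = 0) // scale0r addr0.
have Ht := H t td'; rewrite -(hF t td) -h0 in Ht.
exact: Ht.
Qed.

Lemma big_split_ord_diag (c : 'I_(n + n) -> K) v :
  \sum_i c i * diag v 0 i =
  \sum_i c (lshift n i) * v 0 i + \sum_i c (rshift n i) * conjc (v 0 i).
Proof.
by rewrite big_split_ord; congr (_ + _); apply: eq_bigr => i _; rewrite ?diag_l ?diag_r.
Qed.

Lemma sum_delta (c : 'I_n -> K) i (x : K) (v : 'rV[K]_n) :
  (forall j, v 0 j = if j == i then x else 0) -> \sum_j c j * v 0 j = c i * x.
Proof.
move=> h; rewrite (bigD1 i) //= h eqxx big1 ?addr0 // => j /negPf ji.
by rewrite h ji mulr0.
Qed.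

Lemma dirder_unit F (Ft : 'rV[K]_(n + n) -> K) c u i (x : K) (r B d : R) :
  0 < r -> 0 < d -> expands Ft (diag u) c r B ->
  (forall v, (forall i, cmod (v 0 i) <= d) -> F (u + v) = Ft (diag (u + v))) ->
  dirder (x *: delta_mx 0 i) F u =
    c (munit (lshift n i)) * x + c (munit (rshift n i)) * conjc x.
Proof.
move=> r0 d0 h hF; set v := x *: _.
have hv j : v 0 j = if j == i then x else 0.
  by rewrite !mxE eqxx /=; case: eqP => _; rewrite ?mulr1 ?mulr0.
have d1 : 0 < d / (cmod x + 1) by rewrite divr_gt0 // ltr_wpDl ?cmod_ge0.
rewrite (dirder_expands r0 d1 h (v := v)).
  rewrite (big_split_ord_diag (fun i => c (munit i))).
  rewrite (sum_delta (fun i => c (munit (lshift n i))) hv); congr (_ + _).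
  have hc j : (conjv v) 0 j = if j == i then conjc x else 0.
    by rewrite mxE hv; case: eqP => _ //; rewrite conjc0.
  rewrite -(sum_delta (fun i => c (munit (rshift n i))) hc).
  by apply: eq_bigr => j _; rewrite !mxE.
move=> t td; rewrite -diagZ -diagD; apply: hF => j.
rewrite mxE hv cmodM cmod_real; apply: le_trans (_ : `|t| * (cmod x + 1) <= _).
  rewrite ler_wpM2l //; case: eqP => _; rewrite ?cmod0; have := cmod_ge0 x; lra.
by rewrite -ler_pdivlMr // ltr_wpDl ?cmod_ge0.
Qed.

(** The derivative along v of a function Ft (diag u) is the linear part of Ft
    evaluated on diag v. The directions e_i and i e_i give p + q and i (p - q),
    with p and q the two coefficients, and the Wirtinger combinations separate
    them. *)
Lemma dz_coef F (Ft : 'rV[K]_(n + n) -> K) c u i (r B d : R) :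
  0 < r -> 0 < d -> expands Ft (diag u) c r B ->
  (forall v, (forall i, cmod (v 0 i) <= d) -> F (u + v) = Ft (diag (u + v))) ->
  dz i F u = c (munit (lshift n i)) /\ dzbar i F u = c (munit (rshift n i)).
Proof.
move=> r0 d0 h hF; rewrite /dz /dzbar -[delta_mx 0 i]scale1r.
rewrite !(dirder_unit _ _ r0 d0 h hF) scalerA.
rewrite !(dirder_unit _ _ r0 d0 h hF).
have i2 : ('i%C : K) * 'i%C = -1 by rewrite -expr2 sqr_i.
have ic : conjc ('i%C : K) = - 'i%C by apply/eqP; rewrite eq_complex /= oppr0 !eqxx.
rewrite !mulr1 conjc1 ic; set a := c _; set b := c _; rewrite !mulr1.
have -> : 'i%C * (a * 'i%C + b * - 'i%C) = ('i%C * 'i%C) * (a - b) by ring.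
rewrite i2.
have two : (2 : K) != 0 by rewrite pnatr_eq0.
by split; field.
Qed.

(** At each nearby point the Wirtinger derivative is a coefficient of degree 1 of
    the re-centred series, and those coefficients are power series in the base
    point. *)
Lemma dexpands_wirtinger F c i : dexpands F c ->
  dexpands (dz i F) (hasse c (munit (lshift n i))) /\
  dexpands (dzbar i F) (hasse c (munit (rshift n i))).
Proof.
move=> [Ft [r [B [r0 h hF]]]]; have r20 : 0 < r / 2 by lra.
have key u : (forall j, cmod (u 0 j) <= r / 2) ->
    dz i F u = recentre c (diag u) (munit (lshift n i)) /\
    dzbar i F u = recentre c (diag u) (munit (rshift n i)).
  move=> hu; have hs := reexpand r0 h (cmod_diag hu); rewrite add0r in hs.
  apply: (dz_coef i r20 r20 hs) => v hv; apply: hF => j; rewrite mxE.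
  by have := cmodD (u 0 j) (v 0 j); have := hu j; have := hv j; lra.
have ex ga : expands (fun w => recentre c w ga) 0 (hasse c ga) (r / 2)
    (B / (r / 2) ^+ mabs ga).
  apply: expands_eq (recentre_expands ga 0 r0 h.1); first exact: ltW.
  by move=> w _; rewrite subr0.
split; do 3! eexists; split; [exact: r20|exact: ex| |exact: r20|exact: ex|].
  by move=> u hu; case: (key u hu).
by move=> u hu; case: (key u hu).
Qed.

Lemma dexpands_eq F G c (d : R) : 0 < d -> (forall u, (forall i, cmod (u 0 i) <= d) -> F u = G u) ->
  dexpands F c -> dexpands G c.
Proof.
move=> d0 FG [Ft [r [B [r0 h hF]]]].
have m0 : 0 < Num.min r d by rewrite lt_min r0.
exists Ft, (Num.min r d), B; split=> //.
  by apply: expands_le h; rewrite ?(ltW m0) // ge_min lexx.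
move=> u hu; rewrite -FG ?hF // => i; apply: le_trans (hu i) _; rewrite ge_min lexx ?orbT //.
Qed.

Lemma dexpands_ext F G c d : (forall u, F u = G u) -> (forall al, c al = d al) ->
  dexpands F c -> dexpands G d.
Proof. by move=> /funext -> /funext ->. Qed.

Lemma dexpands2 F G c d : dexpands F c -> dexpands G d ->
  exists Ft Gt (r A B : R), [/\ 0 < r, expands Ft 0 c r A, expands Gt 0 d r B &
    forall u, (forall i, cmod (u 0 i) <= r) -> F u = Ft (diag u) /\ G u = Gt (diag u)].
Proof.
move=> [Ft [r [A [r0 h1 hF]]]] [Gt [r' [B [r'0 h2 hG]]]].
have m0 : 0 < Num.min r r' by rewrite lt_min r0.
exists Ft, Gt, (Num.min r r'), A, B; split=> //.
- by apply: expands_le h1; rewrite ?(ltW m0) // ge_min lexx.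
- by apply: expands_le h2; rewrite ?(ltW m0) // ge_min lexx orbT.
by move=> u hu; split; [apply: hF | apply: hG] => i; apply: le_trans (hu i) _;
  rewrite ge_min lexx ?orbT.
Qed.

Lemma dexpandsD F G c d : dexpands F c -> dexpands G d ->
  dexpands (fun u => F u + G u) (fun al => c al + d al).
Proof.
move=> /dexpands2 h /h[Ft [Gt [r [A [B [r0 h1 h2 hFG]]]]]].
exists (fun w => Ft w + Gt w), r, (A + B); split=> //; first exact: expandsD (ltW r0) h1 h2.
by move=> u /hFG[-> ->].
Qed.

Lemma dexpandsM F G c d : dexpands F c -> dexpands G d ->
  dexpands (fun u => F u * G u) (conv c d).
Proof.
move=> /dexpands2 h /h[Ft [Gt [r [A [B [r0 h1 h2 hFG]]]]]].
exists (fun w => Ft w * Gt w), r, (A * B); split=> //; first exact: expandsM (ltW r0) h1 h2.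
by move=> u /hFG[-> ->].
Qed.

Lemma dexpandsZ k F c : dexpands F c -> dexpands (fun u => k * F u) (fun al => k * c al).
Proof.
move=> [Ft [r [B [r0 h hF]]]]; exists (fun w => k * Ft w), r, (cmod k * B).
by split=> //; [exact: expandsZ | move=> u /hF ->].
Qed.

Lemma dexpands_monom k (ga : multi (n + n)) :
  dexpands (fun u => k * monom ga (diag u)) (fun al => if al == ga then k else 0).
Proof.
have h := expands_monom k ga 0 ler01.
do 3! eexists; split; [exact: ltr01 | exact: h | move=> u _ /=].
by rewrite subr0.
Qed.

Lemma dexpands0 : dexpands (fun _ => 0) (fun _ => 0).
Proof.
by apply: dexpands_ext (dexpandsZ 0 (dexpands_monom 0 (mi0 (n + n)))) => *; rewrite mul0r.
Qed.

Lemma dexpands_sum (T : Type) (s : seq T) (F : T -> 'rV[K]_n -> K) (c : T -> multi (n + n) -> K) :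
  (forall t, dexpands (F t) (c t)) ->
  dexpands (fun u => \sum_(t <- s) F t u) (fun al => \sum_(t <- s) c t al).
Proof.
move=> h; elim: s => [|t s IH].
  by apply: dexpands_ext dexpands0 => *; rewrite big_nil.
by apply: dexpands_ext (dexpandsD (h t) IH) => *; rewrite big_cons.
Qed.

Lemma dexpands_at F c : dexpands F c -> F 0 = c (mi0 (n + n)).
Proof.
move=> [Ft [r [B [r0 h hF]]]]; rewrite hF ?diag0 => [|i]; last by rewrite mxE cmod0 ltW.
exact: expands_at (ltW r0) h.
Qed.

Lemma hasse0 (ga al : multi (n + n)) : hasse (fun _ => 0 : K) ga al = 0.
Proof. by rewrite /hasse mulr0. Qed.

(** The diagonal is totally real: a power series in (u, conj u) vanishing near 0
    has zero coefficients. The constant coefficient is the value at 0; the others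
    are reached by induction on the degree, because the Wirtinger derivatives of
    the zero function vanish and act on the coefficients as formal derivatives. *)
Lemma dexpands_zero_eq F (d : R) : 0 < d -> (forall u, (forall i, cmod (u 0 i) <= d) -> F u = 0) ->
  forall c, dexpands F c -> forall al, c al = 0.
Proof.
move=> d0 F0 c hc al; move: al {-1}(mabs al) (erefl (mabs al)) => al k.
elim: k al d F c d0 F0 hc => [|k IH] al d F c d0 F0 hc E.
  by rewrite (mabs_eq0 E) -(dexpands_at hc) F0 // => i; rewrite mxE cmod0 ltW.
have [j hj] : exists j, al j != 0%N.
  apply/existsP; rewrite -negb_forall; apply/negP => /forallP h0.
  by move: E; rewrite /mabs big1 // => i _; apply/eqP.
have le1 : mle (munit j) al.
  by apply/forallP => i; rewrite ffunE; case: eqP => // ->; rewrite lt0n.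
have Ek : mabs (msub al (munit j)) = k.
  by move: E; rewrite -{1}(msubK le1) mabsD mabs_unit add1n => -[->].
have z : dexpands F (fun _ => 0).
  by apply: dexpands_eq d0 _ dexpands0 => u hu; rewrite F0.
have locz i : exists2 d' : R, 0 < d' & forall u, (forall i, cmod (u 0 i) <= d') ->
    dz i F u = 0 /\ dzbar i F u = 0.
  have [h1 h2] := dexpands_wirtinger i z.
  have D0 ga : hasse (fun _ : multi (n + n) => 0 : K) ga = (fun _ => 0).
    by apply/funext => be; rewrite hasse0.
  rewrite !D0 in h1 h2.
  have [Ft [Gt [r [A [B [r0 hA hB h]]]]]] := dexpands2 h1 h2.
  exists r => // u hu; have [-> ->] := h u hu.
  have zz (H : 'rV[K]_(n + n) -> K) (C : R) : expands H 0 (fun _ => 0) r C -> H (diag u) = 0.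
    move=> [_ /(_ _ (cmod_diag hu))]; rewrite add0r => h0.
    apply: has_sum_unique h0 _; apply: eq_has_sum (@has_sum0 R _) => be; by rewrite mul0r.
  by split; [exact: zz hA | exact: zz hB].
have dc : hasse c (munit j) (msub al (munit j)) = 0.
  have [i0 [ji|ji]] : exists i0 : 'I_n, j = lshift n i0 \/ j = rshift n i0.
    by case: (splitP j) => i0 hi; exists i0; [left|right]; apply/val_inj.
  - have [d' d'0 h] := locz i0.
    apply: (IH _ d' (dz i0 F)) => //; first by move=> u /h[].
    by rewrite ji; case: (dexpands_wirtinger i0 hc).
  - have [d' d'0 h] := locz i0.
    apply: (IH _ d' (dzbar i0 F)) => //; first by move=> u /h[].
    by rewrite ji; case: (dexpands_wirtinger i0 hc).
move: dc; rewrite /hasse msubK // => /eqP; rewrite mulf_eq0 pnatr_eq0 => /orP[|/eqP //].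
rewrite -leqn0 leqNgt => /negP[]; rewrite /mbin prodn_gt0 // => i.
by rewrite bin_gt0; move/forallP: le1; apply.
Qed.

End Wirtinger.

(** * Taylor coefficients and the identity theorem *)

Section Taylor.
Variables (R : realType) (n : nat).
Local Notation K := (CC R).
Local Notation N := (n + n)%N.
Implicit Types (f g h : 'rV[K]_N -> K) (a w z : 'rV[K]_N) (c d : multi N -> K).

Lemma dexpands_expands f a c (r B : R) : 0 < r -> expands f a c r B ->
  dexpands (fun u => f (a + diag u)) c.
Proof.
move=> r0 [cB h]; exists (fun w => f (a + w)), r, B; split=> //.
by split=> // u hu; rewrite add0r; apply: h.
Qed.

Lemma expands_unique f a c d (r r' B B' : R) : 0 < r -> 0 < r' ->
  expands f a c r B -> expands f a d r' B' -> c = d.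
Proof.
move=> r0 r'0 /(dexpands_expands r0) h1 /(dexpands_expands r'0) h2.
apply/funext => al; apply/eqP; rewrite -subr_eq0; apply/eqP.
have h : dexpands (fun u => f (a + diag u) + -1 * f (a + diag u)) (fun al => c al + -1 * d al).
  exact: dexpandsD h1 (dexpandsZ _ h2).
rewrite -(mulN1r (d al)).
by apply: (dexpands_zero_eq ltr01 _ h) => u _; rewrite mulN1r subrr.
Qed.

(** A canonical coefficient family at each point, so that Taylor coefficients are
    functions of the base point; the zero family is the value where f is not
    analytic. *)
Definition taylor f a : multi N -> K :=
  xget (fun _ => 0) [set c | exists r B : R, 0 < r /\ expands f a c r B].

Lemma taylorP f a : analytic f a -> exists r B : R, 0 < r /\ expands f a (taylor f a) r B.
Proof.
move=> [c hc]; rewrite /taylor.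
by have := @xgetI _ (fun _ => 0) [set c | exists r B : R, 0 < r /\ expands f a c r B] c hc.
Qed.

Lemma taylor_eq f a c (r B : R) : 0 < r -> expands f a c r B -> taylor f a = c.
Proof.
move=> r0 h; have [|r' [B' [r'0 h']]] := @taylorP f a; first by exists c, r, B.
exact: expands_unique r'0 r0 h' h.
Qed.

(** One radius and one bound serve at all nearby base points, which makes the
    Cauchy bounds locally uniform. *)
Lemma taylor_near f a : analytic f a -> exists r B : R, 0 < r /\
  forall w, polydisc a r w ->
    expands f w (taylor f w) r B /\ taylor f w = recentre (taylor f a) (w - a).
Proof.
move=> /taylorP[r [B [r0 h]]]; exists (r / 2), B; split=> [|w hw]; first lra.
have hz i : cmod ((w - a) 0 i) <= r / 2 by rewrite !mxE; apply: hw.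
have := reexpand r0 h hz; rewrite addrCA subrr addr0 => h2.
have r20 : 0 < r / 2 by lra.
by rewrite {1}(taylor_eq r20 h2) (taylor_eq r20 h2).
Qed.

Lemma taylor_analytic f a ga : analytic f a -> analytic (fun w => taylor f w ga) a.
Proof.
move=> fa; have [r [B [r0 h]]] := taylor_near fa; have [r' [B' [r'0 h']]] := taylorP fa.
apply: (analytic_eq r0 (f := fun w => recentre (taylor f a) (w - a) ga)).
  by move=> w /h[_ ->].
do 3! eexists; split; last exact: recentre_expands r'0 h'.1.
lra.
Qed.

Lemma analytic_bounded f a : analytic f a -> exists r B : R, 0 < r /\
  forall w, polydisc a r w -> cmod (f w) <= B.
Proof.
move=> [c [r [B [r0 [cB h]]]]]; exists r, B; split=> // w hw.
have hu i : cmod ((w - a) 0 i) <= r by rewrite !mxE; apply: hw.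
have := h _ hu; rewrite addrCA subrr addr0; apply: has_sum_cmod_le.
exact: l1_le_sums cB hu.
Qed.

Lemma polydisc_le a (r r' : R) : r <= r' -> polydisc a r `<=` polydisc a r'.
Proof. by move=> rr w h i; apply: le_trans (h i) rr. Qed.

Lemma polydisc_self a (r : R) : 0 <= r -> polydisc a r a.
Proof. by move=> r0 i; rewrite subrr cmod0. Qed.

Definition vanishes_near h w := exists2 d : R, 0 < d & forall w', polydisc w d w' -> h w' = 0.

Lemma zero_coef_zero h w c (r B : R) : expands h w c r B -> (forall al, c al = 0) ->
  forall w', polydisc w r w' -> h w' = 0.
Proof.
move=> [_ H] c0 w' hw.
have hu i : cmod ((w' - w) 0 i) <= r by rewrite !mxE; apply: hw.
have := H _ hu; rewrite addrCA subrr addr0 => /has_sum_unique; apply.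
by apply: eq_has_sum (@has_sum0 R _) => al; rewrite c0 mul0r.
Qed.

Lemma vanishes_near_coef h w c (r B : R) : 0 < r -> expands h w c r B -> vanishes_near h w ->
  forall al, c al = 0.
Proof.
move=> r0 H [d d0 hd]; apply: (dexpands_zero_eq d0 _ (dexpands_expands r0 H)) => u hu.
by apply: hd; apply/polydisc_add; apply: cmod_diag.
Qed.

(** The radius r/4 leaves room: the expansion at w re-centred at w' converges up
    to distance r/2 from w', hence on the polydisc of radius r/4 around w. *)
Lemma vanishes_near_spread h w w' c (r B : R) : 0 < r -> expands h w c r B ->
  polydisc w (r / 4) w' -> vanishes_near h w' -> vanishes_near h w.
Proof.
move=> r0 H ww' z'; exists (r / 4) => [|y hy]; first lra.
have hz i : cmod ((w' - w) 0 i) <= r / 2 by rewrite !mxE; have := ww' i; lra.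
have := reexpand r0 H hz; rewrite addrCA subrr addr0 => H'.
have r20 : 0 < r / 2 by lra.
have c0 := vanishes_near_coef r20 H' z'.
apply: (zero_coef_zero H' c0) => i.
have -> : y 0 i - w' 0 i = (y 0 i - w 0 i) - (w' 0 i - w 0 i) by ring.
by have := cmodB (y 0 i - w 0 i) (w' 0 i - w 0 i); have := hy i; have := ww' i; lra.
Qed.

(** For fixed y in U, the set of x in U such that h vanishes near (x, conj y) is
    open, is closed in U by vanishes_near_spread, and contains y by
    dexpands_zero_eq; by connectedness it is U. The slices make the connectedness
    of U sufficient. *)
Lemma identity_theorem (U : set 'rV[K]_n) h : open U -> connected U ->
  (forall w, UxUbar U w -> analytic h w) ->
  (forall x, U x -> h (diag x) = 0) -> forall w, UxUbar U w -> h w = 0.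
Proof.
move=> Uo Uc ha h0 _ [x [y [Ux Uy ->]]].
have zd x0 : U x0 -> vanishes_near h (diag x0).
  move=> Ux0; have wW : UxUbar U (diag x0) by exists x0, x0.
  have [r [B [r0 H]]] := taylorP (ha _ wW).
  have [d d0 hd] : exists2 d : R, 0 < d & polydisc x0 d `<=` U.
    by apply: nbhs_polydisc; apply: open_nbhs_nbhs.
  exists r => //; apply: (zero_coef_zero H).
  apply: (dexpands_zero_eq d0 _ (dexpands_expands r0 H)) => u hu.
  by rewrite -diagD h0 //; apply: hd; apply/polydisc_add.
pose S := U `&` [set x | vanishes_near h (row_mx x (conjv y))].
have row_pball (x1 x2 : 'rV[K]_n) (r : R) : 0 <= r -> polydisc x1 r x2 ->
    polydisc (row_mx x1 (conjv y)) r (row_mx x2 (conjv y)).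
  move=> r0 hx i; rewrite !mxE; case: (fintype.split i) => j; first exact: hx.
  by rewrite subrr cmod0.
suff SU : S = U.
  by have : S x by [rewrite SU]; move=> [_ [d d0 hd]]; apply: hd; apply: polydisc_self; exact: ltW.
apply: Uc.
- by exists y; split=> //; apply: zd.
- exists [set x | vanishes_near h (row_mx x (conjv y))] => //.
  rewrite openE => x1 [d d0 hd]; apply: filterS (polydisc_nbhs x1 (_ : 0 < d / 2)); last lra.
  move=> x2 hx; exists (d / 2) => [|w hw]; first lra.
  have d20 : 0 <= d / 2 by lra.
  apply: hd => i; have := row_pball _ _ _ d20 hx i.
  set A := row_mx x1 _; set B := row_mx x2 _ in hw * => hxi.
  have -> : w 0 i - A 0 i = (w 0 i - B 0 i) + (B 0 i - A 0 i) by ring.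
  have := cmodD (w 0 i - B 0 i) (B 0 i - A 0 i); have := hw i.
  by lra.
exists (closure S); first exact: closed_closure.
apply/seteqP; split=> [x1 Sx|x1 [Ux1 Cx]].
  by split; [case: Sx | apply: subset_closure].
split=> //=; have wW : UxUbar U (row_mx x1 (conjv y)) by exists x1, y.
have [r [B [r0 H]]] := taylorP (ha _ wW).
have r40 : 0 < r / 4 by lra.
have [x2 [[_ z2] hx2]] := Cx _ (polydisc_nbhs x1 r40).
by apply: (vanishes_near_spread r0 H _ z2); apply: row_pball hx2; exact: ltW.
Qed.

(** * Analytic families of power series and the formal Laplacian *)

(** Sums, Cauchy products and multiplication by analytic functions preserve both
    the analyticity in w and the locally uniform bound, so every series built from
    Taylor coefficients by these operations has them. *)
Definition coef_field (P : 'rV[K]_N -> multi N -> K) a :=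
  (forall ga, analytic (fun w => P w ga) a) /\
  exists r B : R, 0 < r /\ forall w, polydisc a r w -> l1_le (P w) r B.

Lemma coef_field_taylor f a : analytic f a -> coef_field (taylor f) a.
Proof.
move=> fa; split=> [ga|]; first exact: taylor_analytic.
have [r [B [r0 h]]] := taylor_near fa.
by exists r, B; split=> // w /h[[]].
Qed.

Lemma coef_field2 P Q a : coef_field P a -> coef_field Q a ->
  exists r A B : R, 0 < r /\ forall w, polydisc a r w -> l1_le (P w) r A /\ l1_le (Q w) r B.
Proof.
move=> [_ [r [A [r0 hP]]]] [_ [r' [B [r'0 hQ]]]].
have m0 : 0 < Num.min r r' by rewrite lt_min r0.
have m1 : Num.min r r' <= r by rewrite ge_min lexx.
have m2 : Num.min r r' <= r' by rewrite ge_min lexx orbT.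
exists (Num.min r r'), A, B; split=> // w hw; split.
  exact: l1_le_trans (ltW m0) m1 (lexx A) (hP w (polydisc_le m1 hw)).
exact: l1_le_trans (ltW m0) m2 (lexx B) (hQ w (polydisc_le m2 hw)).
Qed.

Lemma coef_fieldD P Q a : coef_field P a -> coef_field Q a ->
  coef_field (fun w ga => P w ga + Q w ga) a.
Proof.
move=> hP hQ; split=> [ga|]; first exact: analyticD (hP.1 ga) (hQ.1 ga).
have [r [A [B [r0 h]]]] := coef_field2 hP hQ; exists r, (A + B); split=> // w /h[h1 h2].
exact: l1_leD (ltW r0) h1 h2.
Qed.

Lemma coef_field_conv P Q a : coef_field P a -> coef_field Q a ->
  coef_field (fun w => conv (P w) (Q w)) a.
Proof.
move=> hP hQ; split=> [ga|].
  by apply: analytic_sum => p; apply: analyticM; [apply: hP.1 | apply: hQ.1].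
have [r [A [B [r0 h]]]] := coef_field2 hP hQ; exists r, (A * B); split=> // w /h[h1 h2].
exact: l1_le_conv (ltW r0) h1 h2.
Qed.

Lemma coef_field_scale f P a : analytic f a -> coef_field P a ->
  coef_field (fun w ga => f w * P w ga) a.
Proof.
move=> fa [hP [r [B [r0 PB]]]]; split=> [ga|]; first exact: analyticM.
have [r' [A [r'0 fA]]] := analytic_bounded fa.
have m0 : 0 < Num.min r r' by rewrite lt_min r0.
have m1 : Num.min r r' <= r by rewrite ge_min lexx.
have m2 : Num.min r r' <= r' by rewrite ge_min lexx orbT.
exists (Num.min r r'), (A * B); split=> // w hw.
have PBw := PB w (polydisc_le m1 hw).
apply: l1_le_trans (ltW m0) m1 _ (l1_leZ (f w) PBw).
by apply: (ler_wpM2r (sums_le_ge0 PBw)); apply: fA (polydisc_le m2 hw).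
Qed.

Lemma coef_field_mask (Q : pred (multi N)) P a : coef_field P a ->
  coef_field (fun w ga => if Q ga then P w ga else 0) a.
Proof.
move=> [hP [r [B [r0 PB]]]]; split=> [ga|].
  by case: (Q ga); [exact: hP | exact: analytic_cst].
exists r, B; split=> // w /PB; apply: sums_le_trans => al.
by case: (Q al); rewrite // cmod0 mul0r mulr_ge0 ?cmod_ge0 // exprn_ge0 // ltW.
Qed.

Lemma coef_field_single ga0 k a : coef_field (fun w ga => if ga == ga0 then k else 0) a.
Proof.
split=> [ga|]; first exact: analytic_cst.
exists 1, (cmod k * 1 ^+ mabs ga0); split=> // w _; apply: l1_le_single; exact: ler01.
Qed.

Lemma coef_field_sum (T : Type) (s : seq T) (P : T -> 'rV[K]_N -> multi N -> K) a :
  (forall t, coef_field (P t) a) -> coef_field (fun w ga => \sum_(t <- s) P t w ga) a.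
Proof.
move=> h; elim: s => [|t s IH].
  have := coef_field_single (mi0 N) 0 a; congr coef_field; apply/funext => w; apply/funext => ga.
  by rewrite big_nil; case: eqP.
have := coef_fieldD (h t) IH; congr coef_field; apply/funext => w; apply/funext => ga.
by rewrite big_cons.
Qed.

(** The action on coefficients of the operator with constant coefficients
    sum H_ij d/du_i d/dv_j. *)
Definition lap_coef (H : 'I_n -> 'I_n -> K) c : multi N -> K := fun ga =>
  \sum_i \sum_j H i j *
    hasse (hasse c (munit (rshift n j))) (munit (lshift n i)) ga.

Lemma dexpands_lap (H : 'I_n -> 'I_n -> K) (F : 'rV[K]_n -> K) c : dexpands F c ->
  dexpands (fun u => \sum_i \sum_j H i j * dz i (dzbar j F) u) (lap_coef H c).
Proof.
move=> h; apply: dexpands_sum => i; apply: dexpands_sum => j; apply: dexpandsZ.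
by have [_ /(dexpands_wirtinger i)[]] := dexpands_wirtinger j h.
Qed.

Lemma lap_coef_analytic (H : 'rV[K]_N -> 'I_n -> 'I_n -> K) P a :
  (forall i j, analytic (fun w => H w i j) a) ->
  (forall ga, analytic (fun w => P w ga) a) ->
  forall ga, analytic (fun w => lap_coef (H w) (P w) ga) a.
Proof.
move=> hH hP ga; apply: analytic_sum => i; apply: analytic_sum => j.
by apply: analyticM => //; apply: analyticZ; apply: analyticZ.
Qed.

Lemma mbin_unit i (ga : multi N) : mbin (madd (munit i) ga) (munit i) = (ga i).+1.
Proof.
rewrite /mbin (bigD1 i) //= !ffunE eqxx add1n bin1 big1 ?muln1 // => j /negPf ji.
by rewrite !ffunE ji bin0.
Qed.

(** One application raises the degree by 2 and multiplies a coefficient by at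
    most (|ga|+1)(|ga|+2) sum |H_ij|; the factorials make this telescope. *)
Lemma lap_coef_bound (H : 'I_n -> 'I_n -> K) c (s B : R) (k : nat) : 0 < s ->
  (forall ga, cmod (c ga) * s ^+ mabs ga <= B) ->
  forall ga, cmod (iter k (lap_coef H) c ga) * s ^+ (mabs ga + 2 * k) * (mabs ga)`!%:R
    <= B * (\sum_i \sum_j cmod (H i j)) ^+ k * ((mabs ga + 2 * k)`!)%:R.
Proof.
move=> s0 cB; elim: k => [|k IH] ga.
  by rewrite muln0 addn0 expr0 mulr1 /= ler_wpM2r.
rewrite iterS; set d := iter k _ c in IH *; set g := mabs ga.
set Hs := \sum_i \sum_j cmod (H i j) in IH *.
pose Q := B * Hs ^+ k * ((g + 2 * k.+1)`!)%:R.
have key i j : cmod (hasse (hasse d (munit (rshift n j))) (munit (lshift n i)) ga) *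
    s ^+ (g + 2 * k.+1) * g`!%:R <= Q.
  rewrite /hasse !mbin_unit; set ga2 := madd _ _.
  have := IH (madd (munit (rshift n j)) ga2).
  have -> : mabs (madd (munit (rshift n j)) ga2) = g.+2.
    by rewrite /ga2 !mabsD !mabs_unit.
  have -> : (g.+2 + 2 * k = g + 2 * k.+1)%N by lia.
  apply: le_trans; rewrite !cmodM !cmod_nat.
  set X := cmod _; rewrite [leRHS](_ : _ = (g.+1 * g.+2)%:R * (X * s ^+ (g + 2 * k.+1) * g`!%:R)).
    rewrite [leLHS](_ : _ = ((ga (lshift n i)).+1 * (ga2 (rshift n j)).+1)%:R *
        (X * s ^+ (g + 2 * k.+1) * g`!%:R)); last by rewrite natrM; ring.
    apply: ler_wpM2r; first by rewrite !mulr_ge0 ?cmod_ge0 ?exprn_ge0 ?ltW.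
    rewrite ler_nat leq_mul // ltnS ?mabs_ge //.
    by apply: leq_trans (mabs_ge ga2 _) _; rewrite /ga2 mabsD mabs_unit.
  by rewrite !factS !natrM; ring.
have -> : B * Hs ^+ k.+1 * ((g + 2 * k.+1)`!)%:R = Hs * Q by rewrite /Q exprS; ring.
rewrite -mulrA; apply: (le_trans (y := (\sum_i \sum_j cmod (H i j) *
   cmod (hasse (hasse d (munit (rshift n j))) (munit (lshift n i)) ga)) *
   (s ^+ (g + 2 * k.+1) * g`!%:R))).
  apply: ler_wpM2r; first by rewrite mulr_ge0 // exprn_ge0 // ltW.
  apply: (le_trans (cmod_sum _ _ _)); apply: ler_sum => i _.
  apply: (le_trans (cmod_sum _ _ _)); apply: ler_sum => j _; by rewrite cmodM.
rewrite /Hs !mulr_suml; apply: ler_sum => i _; rewrite !mulr_suml; apply: ler_sum => j _.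
by rewrite -mulrA ler_wpM2l ?cmod_ge0 // mulrA.
Qed.

(** The central binomial coefficient is at most 2^(2k), a term of the expansion
    of (1+1)^(2k). *)
Lemma central_bound k : ((2 * k)`! <= 4 ^ k * (k`! * k`!))%N.
Proof.
have h : ('C(2 * k, k) <= 4 ^ k)%N.
  rewrite (_ : 4 ^ k = (1 + 1) ^ (2 * k))%N; last by rewrite expnM.
  rewrite expnDn (bigD1 (inord k)) //= inordK; last by rewrite ltnS leq_pmull.
  by rewrite !exp1n !muln1 leq_addr.
have := @bin_fact (2 * k) k; rewrite leq_pmull // => /(_ isT).
have -> : (2 * k - k = k)%N by lia.
by move=> <-; rewrite leq_mul2r h orbT.
Qed.

Lemma lap_coef_bound0 (H : 'I_n -> 'I_n -> K) c (s B : R) (k : nat) : 0 < s ->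
  (forall ga, cmod (c ga) * s ^+ mabs ga <= B) -> 0 <= B ->
  cmod (iter k (lap_coef H) c (mi0 N)) <=
    B * (4 * (\sum_i \sum_j cmod (H i j)) / s ^+ 2) ^+ k * (k`! * k`!)%:R.
Proof.
move=> s0 cB B0; have := lap_coef_bound H k s0 cB (mi0 N).
rewrite mabs0 add0n mulr1 => h.
set Hs := \sum_i _ in h *.
have Hs0 : 0 <= Hs by rewrite sumr_ge0 // => i _; rewrite sumr_ge0 // => j _; apply: cmod_ge0.
rewrite expr_div_n exprMn -exprM.
have sk : 0 < s ^+ (2 * k) by rewrite exprn_gt0.
rewrite [leRHS](_ : _ = B * Hs ^+ k * (4 ^ k * (k`! * k`!))%:R / s ^+ (2 * k)); last first.
  by rewrite [(4 ^ k * _)%:R]natrM natrX; field; rewrite gt_eqF.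
rewrite ler_pdivlMr //; apply: le_trans h _.
by rewrite ler_wpM2l ?ler_nat ?central_bound // mulr_ge0 // exprn_ge0.
Qed.

End Taylor.

(** * The complex exponential of an analytic function *)

Section Exponential.
Variable R : realType.
Local Notation K := (CC R).

Lemma cexpD (z w : K) : cexp (z + w) = cexp z * cexp w.
Proof.
case: z w => [a b] [c d]; rewrite /cexp /= expRD cosD sinD.
apply/eqP; rewrite eq_complex /=; apply/andP; split; apply/eqP; ring.
Qed.

Lemma rcV (x : R) : rc x^-1 = (rc x)^-1.
Proof. exact: (fmorphV (real_complex R)). Qed.

Lemma sub_iota (A : {fset nat}) : exists m, {subset A <= iota 0 m}.
Proof.
exists (\sum_(i <- A) i).+1 => i iA; rewrite mem_iota /= add0n ltnS.
by rewrite (big_fsetD1 _ iA) /= leq_addr.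
Qed.

Lemma big_seq_fset (I : choiceType) (V : nmodType) (s : seq I) (F : I -> V) :
  uniq s -> \sum_(i <- seq_fset tt s) F i = \sum_(i <- s) F i.
Proof.
move=> us; apply: perm_big; apply: uniq_perm => [||i]; rewrite ?seq_fset_uniq //.
by rewrite seq_fsetE.
Qed.

Lemma sums_le_series (f : nat -> R) (B : R) : (forall k, 0 <= f k) ->
  (forall m, \sum_(0 <= k < m) f k <= B) -> sums_le f B.
Proof.
move=> f0 H A; have [m Am] := sub_iota A; apply: le_trans (H m).
rewrite /index_iota subn0 -(big_seq_fset f (iota_uniq 0 m)).
apply: fset_sum_le => //; apply/fsubsetP => i /Am; by rewrite seq_fsetE.
Qed.

Lemma has_sum_series (f : nat -> R) (s B : R) :
  (forall m, \sum_(0 <= k < m) `|f k| <= B) ->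
  series f @ \oo --> s -> has_sum (fun k => rc (f k)) (rc s).
Proof.
move=> H fs.
have fB : sums_le (fun k => cmod (rc (f k))) B.
  apply: (@sums_le_trans _ _ _ (fun k => `|f k|)); first by move=> k; rewrite cmod_real.
  exact: sums_le_series.
have [t ht] := has_sum_exists fB.
suff -> : rc s = t by [].
apply/eqP; rewrite -subr_eq0; apply/eqP/cmod_eq0/eqP; rewrite eq_le cmod_ge0 andbT.
apply/ler_addgt0Pr => e e0; rewrite add0r; have e2 : 0 < e / 2 by lra.
have [J0 hJ] := ht _ e2; have [m0 hm0] := sub_iota J0.
move/cvgrPdist_lt/(_ _ e2) : fs => [m1 _ hm1].
pose m := maxn m0 m1.
have h1 := hm1 m (leq_maxr _ _); rewrite /= in h1.
have /hJ : (J0 `<=` seq_fset tt (iota 0 m))%fset.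
  apply/fsubsetP => i /hm0; rewrite seq_fsetE !mem_iota /= !add0n => h.
  exact: leq_trans h (leq_maxl _ _).
rewrite big_seq_fset ?iota_uniq // => h2.
have E : \sum_(i <- iota 0 m) rc (f i) = rc (series f m).
  by rewrite /series /= rc_sum /index_iota subn0.
rewrite E in h2.
have -> : rc s - t = rc (s - series f m) + (rc (series f m) - t).
  by rewrite rcD rcN; ring.
have := cmodD (rc (s - series f m)) (rc (series f m) - t).
rewrite cmod_real; lra.
Qed.

Lemma exp_partial_le (x : R) m : \sum_(0 <= k < m) `|x| ^+ k / k`!%:R <= expR `|x|.
Proof.
have h : nondecreasing_seq (series (exp_coeff `|x|)).
  by apply: nondecreasing_series => k _ _; apply: exp_coeff_ge0.
exact: (nondecreasing_cvgn_le h (is_cvg_series_exp_coeff `|x|) m).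
Qed.

Lemma sums_le_exp (x : R) : 0 <= x -> sums_le (fun k => x ^+ k / k`!%:R) (expR x).
Proof.
move=> x0; apply: sums_le_series => [k|m]; first by rewrite divr_ge0 ?exprn_ge0.
by have := exp_partial_le x m; rewrite ger0_norm.
Qed.

Lemma has_sum_ord (I : choiceType) m (k : 'I_m -> I) (f : I -> K) : injective k ->
  (forall i, f i <> 0 -> exists j, i = k j) -> has_sum f (\sum_(j < m) f (k j)).
Proof.
move=> kinj fk.
have us : uniq [seq k j | j <- enum 'I_m] by rewrite map_inj_uniq ?enum_uniq.
have := @has_sum_fin _ _ f (seq_fset tt [seq k j | j <- enum 'I_m]).
rewrite (big_seq_fset f us) big_map big_enum; apply => i.
rewrite seq_fsetE => hi; apply: contrapT => /fk[j ij].
by move/negP: hi; apply; rewrite ij map_f // mem_enum.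
Qed.

(** The exponential is defined through expR, cos and sin, whose series are known;
    the complex series is the Cauchy product of the series of exp x and of
    exp (iy) = cos y + i sin y. *)
Lemma cexp_has_sum (z : K) : has_sum (fun k => z ^+ k / k`!%:R) (cexp z).
Proof.
case: z => x y.
have hx : has_sum (fun k => rc (exp_coeff x k)) (rc (expR x)).
  apply: (@has_sum_series _ _ (expR `|x|)); last exact: is_cvg_series_exp_coeff.
  move=> m; have := exp_partial_le x m; congr (_ <= _); apply: eq_bigr => k _.
  by rewrite normrM normfV normr_nat normrX.
have bnd (b : bool) (k j : nat) : `|(b%:R * (-1) ^+ j * y ^+ k) / k`!%:R| <= `|y| ^+ k / k`!%:R.
  rewrite !normrM normfV !normr_nat normrX normrN1 expr1n mulr1 normrX.
  rewrite ler_wpM2r ?invr_ge0 // ler_piMl ?exprn_ge0 //.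
  by case: b; rewrite ?lexx ?ler01.
have hc : has_sum (fun k => rc (cos_coeff y k)) (rc (cos y)).
  apply: (@has_sum_series _ _ (expR `|y|)).
    move=> m; apply: le_trans (exp_partial_le y m); apply: ler_sum => k _; exact: bnd.
  by rewrite unlock; apply: is_cvg_series_cos_coeff.
have hs : has_sum (fun k => rc (sin_coeff y k)) (rc (sin y)).
  apply: (@has_sum_series _ _ (expR `|y|)).
    move=> m; apply: le_trans (exp_partial_le y m); apply: ler_sum => k _; exact: bnd.
  by rewrite unlock; apply: is_cvg_series_sin_coeff.
pose iy : K := 'i%C * rc y.
have ie m : ('i%C : K) ^+ m.*2 = (-1) ^+ m by rewrite -mul2n exprM sqr_i.
have hiy : has_sum (fun k => iy ^+ k / k`!%:R) (rc (cos y) + 'i%C * rc (sin y)).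
  apply: eq_has_sum (has_sumD hc (has_sumZ 'i%C hs)) => k.
  rewrite /cos_coeff /sin_coeff /= !rcM -!rc_nat.
  rewrite !rcV !rcX rcN -[rc 1]/(1 : K) /iy exprMn.
  rewrite -(odd_double_half k); set m := k./2.
  case: (odd k) => /=; rewrite ?add1n ?add0n /= ?odd_double ?uphalf_double ?doubleK /=.
    rewrite (exprS 'i%C) ie -[rc 0]/(0 : K) -[rc 1]/(1 : K); ring.
  rewrite ie -[rc 0]/(0 : K) -[rc 1]/(1 : K); ring.
have ax : sums_le (fun k => cmod (rc (exp_coeff x k))) (expR `|x|).
  apply: sums_le_trans (sums_le_exp (normr_ge0 x)) => k.
  by rewrite cmod_real normrM normfV normr_nat normrX.
have ay : sums_le (fun k => cmod (iy ^+ k / k`!%:R)) (expR `|y|).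
  apply: sums_le_trans (sums_le_exp (normr_ge0 y)) => k.
  rewrite cmodM cmodX cmodV cmod_nat /iy cmodM cmod_real.
  have -> : cmod ('i%C : K) = 1 by rewrite /cmod /= expr0n /= add0r expr1n sqrtr1.
  by rewrite mul1r.
have E : cexp (x +i* y) = rc (expR x) * (rc (cos y) + 'i%C * rc (sin y)).
  by rewrite /cexp /= -[(cos y) +i* _]/(_ : K) [X in _ * X = _]rc_ReIm.
rewrite E.
have hp := has_sum_prod ax ay hx hiy.
apply: (has_sum_fibres (h := fun p => (p.1 + p.2)%N) hp) => k.
pose kk (j : 'I_k.+1) : nat * nat := ((k - j)%N, nat_of_ord j).
have kinj : injective kk by move=> j1 j2 [_ /val_inj].
have := @has_sum_ord _ _ kk (fun p => if (p.1 + p.2)%N == k then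
   rc (exp_coeff x p.1) * (iy ^+ p.2 / p.2`!%:R) else 0) kinj.
move=> /(_ _)/wrap[].
  move=> [i j] /=; case: eqP => // ij _.
  have jk : (j < k.+1)%N by rewrite ltnS -ij leq_addl.
  by exists (Ordinal jk); rewrite /kk /= -ij addnK.
rewrite (_ : \sum_(j < k.+1) _ = (x +i* y) ^+ k / k`!%:R) //.
have -> : (x +i* y) = rc x + iy :> K by rewrite [LHS]rc_ReIm.
rewrite exprDn mulr_suml; apply: eq_bigr => j _ /=.
have jk : (j <= k)%N by rewrite -ltnS.
rewrite subnK // eqxx /exp_coeff /= rcM rcX rcV rc_nat.
have hb : ('C(k, j)%:R : K) = k`!%:R / (j`!%:R * (k - j)`!%:R).
  rewrite -(bin_fact jk) !natrM mulfK // mulf_neq0 //;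
  by rewrite pnatr_eq0 -lt0n fact_gt0.
rewrite -[_ *+ 'C(k, j)]mulr_natl hb; field.
by rewrite !pnatr_eq0 -!lt0n !fact_gt0.
Qed.

End Exponential.

Section ExpComposition.
Variables (R : realType) (N : nat).
Local Notation K := (CC R).

Fixpoint conv_pow (c : multi N -> K) (k : nat) : multi N -> K :=
  if k is k'.+1 then conv c (conv_pow c k') else fun al => if al == mi0 N then 1 else 0.

Lemma l1_le_conv_pow c (r B : R) k : 0 <= r -> l1_le c r B -> l1_le (conv_pow c k) r (B ^+ k).
Proof.
move=> r0 cB; elim: k => [|k IH].
  by have := @l1_le_single R N (mi0 N) 1 r r0; rewrite mabs0 expr0 mulr1 cmod1.
by rewrite exprS; apply: l1_le_conv.
Qed.

Lemma expandsX (f : 'rV[K]_N -> K) a c (r B : R) k : 0 <= r -> expands f a c r B ->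
  expands (fun w => f w ^+ k) a (conv_pow c k) r (B ^+ k).
Proof.
move=> r0 h; elim: k => [|k IH].
  have := expands_monom 1 (mi0 N) a r0; rewrite mabs0 expr0 mulr1 cmod1.
  by apply: expands_eq r0 _ => w _; rewrite monom0 mulr1.
rewrite exprS; apply: (expands_eq r0) (expandsM r0 h IH) => w _.
by rewrite exprS.
Qed.

(** The family (c^k)_al u^al / k! is summable with total at most exp B. Summed
    over al first it gives the series of the exponential, summed over k first it
    gives the coefficients e. *)
Lemma analytic_cexp (f : 'rV[K]_N -> K) a : analytic f a ->
  analytic (fun w => cexp (f w)) a.
Proof.
move=> [c [r [B [r0 h]]]]; have r00 := ltW r0; have cB := h.1.
have B0 := sums_le_ge0 cB.
pose e0 k al := conv_pow c k al / k`!%:R.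
have nme0 k al : cmod (e0 k al) = cmod (conv_pow c k al) / k`!%:R by rewrite cmodM cmodV cmod_nat.
pose F (p : multi N * nat) := cmod (e0 p.2 p.1) * r ^+ mabs p.1.
have F0 p : 0 <= F p by rewrite mulr_ge0 ?cmod_ge0 ?exprn_ge0.
have FB : sums_le F (expR B).
  apply: (sums_le_fibres (h := snd) F0 _ (sums_le_exp B0)) => k.
  apply: (@sums_le_reindex _ _ _ (fun al => (al, k))) => [? ? [] //||].
    by move=> [al k'] /=; case: eqP => // -> _; exists al.
  rewrite mulrC; have := sums_leZ (_ : 0 <= (k`!%:R^-1 : R)) (l1_le_conv_pow k r00 cB).
  move=> /(_ _)/wrap[]; first by rewrite invr_ge0.
  by apply: sums_le_trans => al; rewrite /= eqxx /F /= nme0 mulrAC [leRHS]mulrC.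
have [S hS SB] := sums_le_iter F0 FB.
have rne al : 0 < r ^+ mabs al by rewrite exprn_gt0.
have ec al : sums_le (fun k => cmod (e0 k al)) (S al / r ^+ mabs al).
  by move=> L; rewrite ler_pdivlMr // mulr_suml; apply: hS.
pose e al := sval (cid (has_sum_exists (ec al))).
have he al : has_sum (fun k => e0 k al) (e al) by rewrite /e; case: (cid _).
exists e, r, (expR B); split=> //; split.
  apply: sums_le_trans SB => al; rewrite -ler_pdivlMr //.
  exact: has_sum_cmod_le (ec al) (he al).
move=> u hu.
pose T (p : multi N * nat) := e0 p.2 p.1 * monom p.1 u.
have TB : sums_le (fun p => cmod (T p)) (expR B).
  apply: sums_le_trans FB => p; rewrite cmodM ler_wpM2l ?cmod_ge0 //; exact: cmod_monom_le.
have [s hs] := has_sum_exists TB.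
have -> : cexp (f (a + u)) = s.
  apply: has_sum_unique (cexp_has_sum (f (a + u))) _.
  apply: (has_sum_fibres (h := snd) hs) => k.
  apply: (@has_sum_reindex _ _ _ (fun al => (al, k))) => [? ? [] //||].
    by move=> [al k'] /=; case: eqP => // -> _; exists al.
  have [_ /(_ u hu)] := expandsX k r00 h => hk.
  rewrite mulrC; apply: eq_has_sum (has_sumZ (k`!%:R^-1) hk) => al.
  by rewrite /= eqxx /T /e0 /=; ring.
apply: (has_sum_iter hs) => al; rewrite mulrC.
by apply: eq_has_sum (has_sumZ (monom al u) (he al)) => k; rewrite mulrC.
Qed.

End ExpComposition.

(** * Monomials, restrictions and derivatives on C^n x C^n *)

Section Halves.
Variables (R : realType) (n : nat).
Local Notation K := (CC R).
Local Notation N := (n + n)%N.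

Definition lzero (ga : multi N) := [forall i, ga (lshift n i) == 0%N].
Definition rzero (ga : multi N) := [forall i, ga (rshift n i) == 0%N].

Definition mjoin (al be : multi n) : multi N :=
  [ffun i => match fintype.split i with inl j => al j | inr j => be j end].

Lemma mjoin_l al be i : mjoin al be (lshift n i) = al i.
Proof. by rewrite ffunE -[lshift n i]/(unsplit (inl i)) unsplitK. Qed.

Lemma mjoin_r al be i : mjoin al be (rshift n i) = be i.
Proof. by rewrite ffunE -[rshift n i]/(unsplit (inr i)) unsplitK. Qed.

Lemma monom_row (V : comNzRingType) (ga : multi N) (u v : 'rV[V]_n) :
  monom ga (row_mx u v) =
  (\prod_i u 0 i ^+ ga (lshift n i)) * (\prod_i v 0 i ^+ ga (rshift n i)).
Proof.
rewrite /monom big_split_ord /=; congr (_ * _); apply: eq_bigr => i _.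
  by rewrite row_mxEl.
by rewrite row_mxEr.
Qed.

Lemma prod_exp0 (V : idomainType) (f : 'I_n -> nat) :
  \prod_i (0 : 'rV[V]_n) 0 i ^+ f i = ([forall i, f i == 0%N])%:R.
Proof.
case: (boolP [forall i, f i == 0%N]) => [/forallP h|].
  by rewrite big1 // => i _; rewrite (eqP (h i)) expr0.
rewrite negb_forall => /existsP[j hj].
by rewrite (bigD1 j) //= mxE expr0n (negPf hj) mul0r.
Qed.

Lemma monom_mask_r (V : idomainType) (ga : multi N) (w : 'rV[V]_N) :
  monom ga (row_mx 0 (rsubmx w)) = if lzero ga then monom ga w else 0.
Proof.
rewrite monom_row (prod_exp0 V (fun i => ga (lshift n i))) -/(lzero ga).
case: (boolP (lzero ga)) => [/forallP h|_]; last by rewrite mul0r.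
rewrite -[w in RHS]hsubmxK monom_row; congr (_ * _).
by rewrite big1 // => i _; rewrite (eqP (h i)) expr0.
Qed.

Lemma monom_mask_l (V : idomainType) (ga : multi N) (w : 'rV[V]_N) :
  monom ga (row_mx (lsubmx w) 0) = if rzero ga then monom ga w else 0.
Proof.
rewrite monom_row (prod_exp0 V (fun i => ga (rshift n i))) -/(rzero ga).
case: (boolP (rzero ga)) => [/forallP h|_]; last by rewrite mulr0.
rewrite -[w in RHS]hsubmxK monom_row; congr (_ * _).
by rewrite [RHS]big1 // => i _; rewrite (eqP (h i)) expr0.
Qed.

Lemma monom_mjoin al be (u : 'rV[K]_n) :
  monom (mjoin al be) (diag u) = monom al u * monom be (conjv u).
Proof.
rewrite monom_row; congr (_ * _); apply: eq_bigr => i _.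
  by rewrite mjoin_l.
by rewrite mjoin_r.
Qed.

(** Restricting a function to the set where one half of the variables is frozen
    keeps the coefficients supported on the other half. *)
Definition mask (Q : pred (multi N)) (c : multi N -> K) (ga : multi N) : K :=
  if Q ga then c ga else 0.

Lemma l1_le_mask Q c (r B : R) : 0 <= r -> l1_le c r B -> l1_le (mask Q c) r B.
Proof.
move=> r0; apply: sums_le_trans => al; rewrite /mask.
by case: (Q al); rewrite // cmod0 mul0r mulr_ge0 ?cmod_ge0 // exprn_ge0.
Qed.

Lemma dexpands_mask_r (f : 'rV[K]_N -> K) (x : 'rV[K]_n) : analytic f (diag x) ->
  dexpands (fun u => f (row_mx x (conjv (x + u)))) (mask lzero (taylor f (diag x))).
Proof.
move=> /taylorP[r [B [r0 [cB h]]]].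
exists (fun w => f (diag x + row_mx 0 (rsubmx w))), r, B; split=> //.
  split; first exact: l1_le_mask (ltW r0) cB.
  move=> w hw; rewrite add0r.
  have hw' i : cmod ((row_mx 0 (rsubmx w) : 'rV[K]_N) 0 i) <= r.
    by rewrite mxE; case: (fintype.split i) => j; rewrite !mxE ?cmod0 ?(ltW r0) ?hw.
  apply: eq_has_sum (h _ hw') => ga; rewrite monom_mask_r /mask.
  by case: (lzero ga); rewrite ?mulr0 ?mul0r.
move=> u _; rewrite row_mxKr conjvD /diag add_row_mx addr0 //.
Qed.

Lemma dexpands_mask_l (f : 'rV[K]_N -> K) (x : 'rV[K]_n) : analytic f (diag x) ->
  dexpands (fun u => f (row_mx (x + u) (conjv x))) (mask rzero (taylor f (diag x))).
Proof.
move=> /taylorP[r [B [r0 [cB h]]]].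
exists (fun w => f (diag x + row_mx (lsubmx w) 0)), r, B; split=> //.
  split; first exact: l1_le_mask (ltW r0) cB.
  move=> w hw; rewrite add0r.
  have hw' i : cmod ((row_mx (lsubmx w) 0 : 'rV[K]_N) 0 i) <= r.
    by rewrite mxE; case: (fintype.split i) => j; rewrite !mxE ?cmod0 ?(ltW r0) ?hw.
  apply: eq_has_sum (h _ hw') => ga; rewrite monom_mask_l /mask.
  by case: (rzero ga); rewrite ?mulr0 ?mul0r.
move=> u _; rewrite row_mxKl /diag add_row_mx addr0 //.
Qed.

Lemma dexpands_taylor (f : 'rV[K]_N -> K) (x : 'rV[K]_n) : analytic f (diag x) ->
  dexpands (fun u => f (diag (x + u))) (taylor f (diag x)).
Proof.
move=> /taylorP[r [B [r0 h]]]; apply: dexpands_ext (dexpands_expands r0 h) => // u.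
by rewrite diagD.
Qed.

Lemma dirder_shift v (f : 'rV[K]_n -> K) (x u : 'rV[K]_n) :
  dirder v f (x + u) = dirder v (fun y => f (x + y)) u.
Proof.
have E (t : R) : x + u + (t%:C : K) *: v = x + (u + (t%:C : K) *: v).
  exact: (esym (addrA x u _)).
exact: (f_equal2 (fun g1 g2 : R -> R => derive1 g1 0 +i* derive1 g2 0)
  (funext (fun t => congr1 (fun y => complex.Re (f y)) (E t)))
  (funext (fun t => congr1 (fun y => complex.Im (f y)) (E t)))).
Qed.

Definition translates (x : 'rV[K]_n) (D : ('rV[K]_n -> K) -> 'rV[K]_n -> K) :=
  forall f, (fun u => D f (x + u)) = D (fun y => f (x + y)).

Lemma dz_shift i x : translates x (dz i).
Proof. by move=> f; apply/funext => u; rewrite /dz !dirder_shift. Qed.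

Lemma dzbar_shift i x : translates x (dzbar i).
Proof. by move=> f; apply/funext => u; rewrite /dzbar !dirder_shift. Qed.

Lemma translates_foldr x (D : 'I_n -> ('rV[K]_n -> K) -> 'rV[K]_n -> K)
    (al : multi n) (s : seq 'I_n) : (forall i, translates x (D i)) ->
  translates x (fun f => foldr (fun i g => iter (al i) (D i) g) f s).
Proof.
move=> hD f; elim: s => [//|i s IH] /=; rewrite -IH.
by elim: (al i) => [//|k IHk]; rewrite !iterS -IHk -hD.
Qed.

Lemma dzs_shift al x : translates x (dzs al).
Proof. exact: translates_foldr (fun i => dz_shift i x). Qed.

Lemma dzbars_shift be x : translates x (dzbars be).
Proof. exact: translates_foldr (fun i => dzbar_shift i x). Qed.

Definition derive_coefs (k : 'I_n -> 'I_N) (al : multi n) (c : multi N -> K) :=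
  foldr (fun i d => iter (al i) (fun d => hasse d (munit (k i))) d) c (enum 'I_n).

Lemma mfact_add (ga de : multi N) :
  mfact (madd ga de) = (mbin (madd ga de) ga * (mfact ga * mfact de))%N.
Proof.
rewrite /mfact /mbin -!big_split; apply: eq_bigr => i _ /=; rewrite !ffunE.
by rewrite -(@bin_fact (ga i + de i) (ga i)) ?leq_addr // addKn.
Qed.

Lemma mfact_unit j : mfact (munit j : multi N) = 1%N.
Proof. by rewrite /mfact big1 // => i _; rewrite ffunE; case: eqP. Qed.

Lemma mfact0 m : mfact (mi0 m) = 1%N.
Proof. by rewrite /mfact big1 // => i _; rewrite ffunE. Qed.

(** With coefficients multiplied by their factorials, a formal derivative becomes
    a shift of indices, so that iterated derivatives compose without binomials. *)
Lemma hasse_norm (c : multi N -> K) j (ga : multi N) :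
  (mfact ga)%:R * hasse c (munit j) ga = (mfact (madd (munit j) ga))%:R * c (madd (munit j) ga).
Proof. by rewrite /hasse mfact_add mfact_unit mul1n natrM; ring. Qed.

Definition mpush (k : 'I_n -> 'I_N) (al : multi n) (s : seq 'I_n) : multi N :=
  foldr (fun i g => iter (al i) (madd (munit (k i))) g) (mi0 N) s.

Lemma derive_coefs_norm k al (c : multi N -> K) : derive_coefs k al c (mi0 N) =
  (mfact (mpush k al (enum 'I_n)))%:R * c (mpush k al (enum 'I_n)).
Proof.
suff H s ga : (mfact ga)%:R * foldr (fun i d =>
     iter (al i) (fun d => hasse d (munit (k i))) d) c s ga =
   (mfact (madd (mpush k al s) ga))%:R * c (madd (mpush k al s) ga).
  by have := H (enum 'I_n) (mi0 N); rewrite mfact0 mul1r madd0.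
elim: s ga => [|i s IH] ga /=; first by rewrite madd0l.
elim: (al i) ga => [|m IHm] ga /=; first exact: IH.
rewrite hasse_norm IHm; congr ((mfact _)%:R * c _);
  by rewrite maddA [madd _ (munit _)]maddC.
Qed.

Lemma mpushE k al (j : 'I_N) :
  mpush k al (enum 'I_n) j = (\sum_i al i * (k i == j))%N.
Proof.
rewrite -big_enum /= /mpush; elim: (enum 'I_n) => [|i s IH] /=.
  by rewrite big_nil ffunE.
rewrite big_cons -IH; elim: (al i) => [|m IHm] /=; first by rewrite mul0n.
by rewrite ffunE IHm ffunE mulSn addnA [j == _]eq_sym.
Qed.

Lemma mpush_l al : mpush (@lshift n n) al (enum 'I_n) = mjoin al (mi0 n).
Proof.
apply/ffunP => j; rewrite mpushE.
case: (split_ordP j) => i ->; rewrite ?mjoin_l ?mjoin_r.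
  rewrite (bigD1 i) //= eqxx muln1 big1 ?addn0 // => i' /negPf h.
  by rewrite (inj_eq (@lshift_inj _ _)) h muln0.
by rewrite ffunE big1 // => i' _; rewrite eq_lrshift muln0.
Qed.

Lemma mpush_r al : mpush (@rshift n n) al (enum 'I_n) = mjoin (mi0 n) al.
Proof.
apply/ffunP => j; rewrite mpushE.
case: (split_ordP j) => i ->; rewrite ?mjoin_l ?mjoin_r.
  by rewrite ffunE big1 // => i' _; rewrite eq_rlshift muln0.
rewrite (bigD1 i) //= eqxx muln1 big1 ?addn0 // => i' /negPf h.
by rewrite (inj_eq (@rshift_inj _ _)) h muln0.
Qed.

Lemma dexpands_dzs al (F : 'rV[K]_n -> K) c :
  dexpands F c -> dexpands (dzs al F) (derive_coefs (@lshift n n) al c).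
Proof.
move=> h; rewrite /dzs /derive_coefs; elim: (enum 'I_n) => //= i s IH.
by elim: (al i) => //= m /(dexpands_wirtinger i)[].
Qed.

Lemma dexpands_dzbars be (F : 'rV[K]_n -> K) c :
  dexpands F c -> dexpands (dzbars be F) (derive_coefs (@rshift n n) be c).
Proof.
move=> h; rewrite /dzbars /derive_coefs; elim: (enum 'I_n) => //= i s IH.
by elim: (be i) => //= m /(dexpands_wirtinger i)[].
Qed.

Lemma mjoin_inj al be al' be' : mjoin al be = mjoin al' be' -> al = al' /\ be = be'.
Proof.
move=> /ffunP h; split; apply/ffunP => i.
  by have := h (lshift n i); rewrite !mjoin_l.
by have := h (rshift n i); rewrite !mjoin_r.
Qed.

Lemma mfact_mjoin al be : mfact (mjoin al be) = (mfact al * mfact be)%N.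
Proof.
rewrite /mfact big_split_ord; congr (_ * _)%N; apply: eq_bigr => i _.
  by rewrite mjoin_l.
by rewrite mjoin_r.
Qed.

Lemma dzs_monom al al' : dzs al' (fun u : 'rV[K]_n => monom al u) 0 =
  if al' == al then (mfact al)%:R else 0.
Proof.
have h : dexpands (fun u : 'rV[K]_n => monom al u)
    (fun ga => if ga == mjoin al (mi0 n) then 1 else 0).
  apply: dexpands_ext (dexpands_monom 1 (mjoin al (mi0 n))) => // u.
  by rewrite monom_mjoin monom0 mulr1 mul1r.
rewrite (dexpands_at (dexpands_dzs al' h)) derive_coefs_norm mpush_l mfact_mjoin mfact0 muln1.
have [->|ne] := eqVneq al' al; first by rewrite eqxx mulr1.
by case: eqP => [/mjoin_inj[E _]|_]; [rewrite E eqxx in ne | rewrite mulr0].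
Qed.

Lemma dzbars_monom be be' : dzbars be' (fun u : 'rV[K]_n => monom be (conjv u)) 0 =
  if be' == be then (mfact be)%:R else 0.
Proof.
have h : dexpands (fun u : 'rV[K]_n => monom be (conjv u))
    (fun ga => if ga == mjoin (mi0 n) be then 1 else 0).
  apply: dexpands_ext (dexpands_monom 1 (mjoin (mi0 n) be)) => // u.
  by rewrite monom_mjoin monom0 mul1r mul1r.
rewrite (dexpands_at (dexpands_dzbars be' h)) derive_coefs_norm mpush_r mfact_mjoin mfact0 mul1n.
have [->|ne] := eqVneq be' be; first by rewrite eqxx mulr1.
by case: eqP => [/mjoin_inj[_ E]|_]; [rewrite E eqxx in ne | rewrite mulr0].
Qed.

End Halves.

(** * The coefficients in closed form, continued off the diagonal *)

Section Explicit.
Variables (R : realType) (n : nat).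
Local Notation K := (CC R).
Local Notation N := (n + n)%N.
Variables (phit phit' bt : 'rV[K]_N -> K).

Definition single (ga : multi N) (k : K) (al : multi N) : K := if al == ga then k else 0.

(** The Taylor coefficient of phit at w whose restriction to the diagonal is the
    Levi matrix G_ij. *)
Definition levi_ext i j w : K := taylor phit w (madd (munit (rshift n j)) (munit (lshift n i))).
Definition levi_ext_mx w : 'M[K]_n := \matrix_(i, j) levi_ext i j w.
Definition det_levi_ext w : K := \det (levi_ext_mx w).

(** The matrix G^ij, as b times the transposed adjugate of G. *)
Definition levi_inv_ext w i j : K := bt w * (\adj (levi_ext_mx w)) j i.

(** The four terms of psi contribute the full Taylor series of phit, its
    restrictions to each half of the variables, and its value. *)
Definition cfun_coef w (ga : multi N) : K :=
  (\sum_i \sum_j levi_ext i j w * single (mjoin (munit i) (munit j)) 1 ga)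
  + (mask (@lzero n) (taylor phit w) ga + (mask (@rzero n) (taylor phit w) ga +
     (- phit w * single (mi0 N) 1 ga + -1 * taylor phit w ga))).

Definition exp_phi' w : K := cexp (phit' w).
Definition exp_Nphi' w : K := cexp (- phit' w).

(** The factor exp (- psi') splits into four exponentials, each a restriction of
    exp phit' or of exp (- phit'), whose Taylor coefficients are analytic in w. *)
Definition cfun'_coef w (ga : multi N) : K :=
  exp_Nphi' w * conv (conv (mask (@lzero n) (taylor exp_phi' w))
                           (mask (@rzero n) (taylor exp_phi' w)))
               (conv (taylor exp_Nphi' w) (taylor det_levi_ext w)) ga.

Definition integrand_coef w m al be : multi N -> K :=
  conv (conv (conv_pow (cfun_coef w) m) (single (mjoin al be) 1)) (cfun'_coef w).

(** The value at 0 of a power of the Laplacian is the coefficient of index 0. *)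
Definition coef_ext (l : nat) (al be : multi n) (w : 'rV[K]_N) : K :=
  (l`!%:R)^-1 * (bt w * \sum_(m < (2 * l)%N.+1)
    iter (l + m)%N (lap_coef (levi_inv_ext w)) (integrand_coef w m al be) (mi0 N)
    / (m`! * (l + m)`!)%N%:R).

Section At.
Variable a : 'rV[K]_N.
Hypotheses (phi_a : analytic phit a) (phi'_a : analytic phit' a) (bt_a : analytic bt a).

Lemma levi_ext_analytic i j : analytic (levi_ext i j) a.
Proof. exact: taylor_analytic. Qed.

Lemma det_levi_ext_analytic : analytic det_levi_ext a.
Proof. by apply: analytic_det => i j; apply: levi_ext_analytic. Qed.

Lemma levi_inv_ext_analytic i j : analytic (fun w => levi_inv_ext w i j) a.
Proof.
apply: analyticM => //.
apply: (analytic_eq ltr01 (f := fun w => (-1) ^+ (i + j) *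
  \det (\matrix_(i', j') levi_ext (lift i i') (lift j j') w))).
  move=> w _; rewrite mxE /cofactor; congr (_ * \det _).
  by apply/matrixP => i' j'; rewrite !mxE.
by apply: analyticZ; apply: analytic_det => i' j'; apply: levi_ext_analytic.
Qed.

Lemma cfun_coef_field : coef_field cfun_coef a.
Proof.
apply: coef_fieldD.
  apply: coef_field_sum => i; apply: coef_field_sum => j; apply: coef_field_scale.
    exact: levi_ext_analytic.
  exact: coef_field_single.
have hp := coef_field_taylor phi_a.
apply: coef_fieldD; first exact: (coef_field_mask (@lzero n) hp).
apply: coef_fieldD; first exact: (coef_field_mask (@rzero n) hp).
apply: coef_fieldD; last exact: (coef_field_scale (analytic_cst (-1) a) hp).
exact: (coef_field_scale (analyticN phi_a) (coef_field_single (mi0 N) 1 a)).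
Qed.

Lemma cfun'_coef_field : coef_field cfun'_coef a.
Proof.
have h1 : analytic exp_phi' a by apply: analytic_cexp.
have h2 : analytic exp_Nphi' a by apply: analytic_cexp; apply: analyticN.
have he := coef_field_conv (coef_field_mask (@lzero n) (coef_field_taylor h1))
  (coef_field_mask (@rzero n) (coef_field_taylor h1)).
have hd := coef_field_conv (coef_field_taylor h2) (coef_field_taylor det_levi_ext_analytic).
exact: (coef_field_scale h2 (coef_field_conv he hd)).
Qed.

Lemma coef_field_conv_pow P m : coef_field P a -> coef_field (fun w => conv_pow (P w) m) a.
Proof.
by move=> h; elim: m => [|m IH] /=; [exact: coef_field_single | exact: coef_field_conv].
Qed.

Lemma integrand_coef_field m al be : coef_field (fun w => integrand_coef w m al be) a.
Proof.
apply: coef_field_conv; last exact: cfun'_coef_field.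
apply: coef_field_conv; last exact: coef_field_single.
by apply: coef_field_conv_pow; apply: cfun_coef_field.
Qed.

Lemma coef_ext_analytic l al be : analytic (coef_ext l al be) a.
Proof.
apply: analyticZ; apply: analyticM => //; apply: analytic_sum => m.
apply: analyticM; last exact: analytic_cst.
move: (mi0 N); elim: (l + m)%N => [|k IH] ga /=; first by apply: (integrand_coef_field m al be).1.
by apply: lap_coef_analytic => // i j; apply: levi_inv_ext_analytic.
Qed.

End At.

Lemma dexpands_conv_pow (F : 'rV[K]_n -> K) c m :
  dexpands F c -> dexpands (fun u => F u ^+ m) (conv_pow c m).
Proof.
move=> h; elim: m => [|m IH] /=.
  apply: dexpands_ext (dexpands_monom 1 (mi0 N)) => // u; by rewrite monom0 mulr1.
by apply: dexpands_ext (dexpandsM h IH) => // u; rewrite exprS.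
Qed.

Section Diagonal.
Variables (U : set 'rV[K]_n) (phi : 'rV[K]_n -> R).
Hypotheses (Uo : open U)
  (phit_an : forall w, UxUbar U w -> analytic phit w)
  (phit'_an : forall w, UxUbar U w -> analytic phit' w)
  (phit_diag : forall x, U x -> phit (diag x) = rc (phi x))
  (bt_diag : forall x, U x -> bt (diag x) = bfun phi x)
  (levi_det : forall x, U x -> \det (levi phi x) != 0).

Lemma diag_W x : U x -> UxUbar U (diag x).
Proof. by move=> Ux; exists x, x. Qed.

Lemma U_ball x : U x -> exists2 d : R, 0 < d &
  forall u : 'rV[K]_n, (forall i, cmod (u 0 i) <= d) -> U (x + u).
Proof.
move=> Ux; have [d d0 h] := nbhs_polydisc (open_nbhs_nbhs (conj Uo Ux)).
by exists d => // u hu; apply: h; apply/polydisc_add.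
Qed.

(** Both derivatives can be read off the expansion of phi at x, since phi is the
    restriction of phit to the diagonal. *)
Lemma levi_diag x : U x -> levi phi x = levi_ext_mx (diag x).
Proof.
move=> Ux; apply/matrixP => i j; rewrite !mxE.
have [d d0 hd] := U_ball Ux.
have h : dexpands (fun u => rc (phi (x + u))) (taylor phit (diag x)).
  apply: (dexpands_eq d0) (dexpands_taylor (phit_an (diag_W Ux))) => u /hd.
  exact: phit_diag.
have [_ h1] := dexpands_wirtinger j h; have [h2 _] := dexpands_wirtinger i h1.
have := dexpands_at h2; rewrite -(dzbar_shift j x (fun z => rc (phi z))).
rewrite -(dz_shift i x (dzbar j (fun z => rc (phi z)))) addr0 => ->.
have dc0 (c : multi N -> K) i' : hasse c (munit i') (mi0 N) = c (munit i').
  by rewrite /hasse mbin_unit madd0 ffunE mul1r.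
rewrite dc0 /hasse mbin_unit ffunE eq_rlshift mul1r //.
Qed.

Lemma invmx_adj (A : 'M[K]_n) i j : \det A != 0 ->
  (invmx A)^T i j = (\det A)^-1 * (\adj A) j i.
Proof. by move=> dA; rewrite mxE /invmx unitmxE unitfE dA mxE. Qed.

Lemma levi_inv_diag x i j : U x -> (invmx (levi phi x))^T i j = levi_inv_ext (diag x) i j.
Proof.
move=> Ux; rewrite invmx_adj; last exact: levi_det.
by rewrite /levi_inv_ext (bt_diag Ux) /bfun (levi_diag Ux).
Qed.

Lemma dexpands_cfun x : U x -> dexpands (cfun phi phit x) (cfun_coef (diag x)).
Proof.
move=> Ux; have pa := phit_an (diag_W Ux).
have h1 : dexpands (fun u : 'rV[K]_n => \sum_i \sum_j levi phi x i j * u 0 i * conjc (u 0 j))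
   (fun ga => \sum_i \sum_j levi_ext i j (diag x) * single (mjoin (munit i) (munit j)) 1 ga).
  apply: dexpands_sum => i; apply: dexpands_sum => j.
  apply: dexpands_ext (dexpandsZ (levi_ext i j (diag x))
    (dexpands_monom 1 (mjoin (munit i) (munit j)))) => // u.
  by rewrite monom_mjoin !monom_unit levi_diag // !mxE mul1r mulrA.
have h2 : dexpands (fun u : 'rV[K]_n => - phit (diag x))
    (fun ga => - phit (diag x) * single (mi0 N) 1 ga).
  apply: dexpands_ext (dexpandsZ (- phit (diag x)) (dexpands_monom 1 (mi0 N))) => // u.
  by rewrite monom0 !mulr1.
have h3 := dexpandsD h1 (dexpandsD (dexpands_mask_r pa) (dexpandsD (dexpands_mask_l pa)
  (dexpandsD h2 (dexpandsZ (-1) (dexpands_taylor pa))))).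
apply: dexpands_ext h3 => // u; rewrite /cfun /psi; ring.
Qed.

Lemma dexpands_cfun' x : U x -> dexpands (cfun' phi phit' x) (cfun'_coef (diag x)).
Proof.
move=> Ux; have pa := phit'_an (diag_W Ux).
have ea : analytic exp_phi' (diag x) by apply: analytic_cexp.
have eia : analytic exp_Nphi' (diag x) by apply: analytic_cexp; apply: analyticN.
have da := det_levi_ext_analytic (phit_an (diag_W Ux)).
have [d d0 hd] := U_ball Ux.
have h := dexpandsZ (exp_Nphi' (diag x))
  (dexpandsM (dexpandsM (dexpands_mask_r ea) (dexpands_mask_l ea))
  (dexpandsM (dexpands_taylor eia) (dexpands_taylor da))).
apply: (dexpands_eq d0) h => u /hd Uxu.
rewrite /cfun' levi_diag // -/(det_levi_ext _) /psi /exp_phi' /exp_Nphi'.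
set p1 := phit' (row_mx x _); set p2 := phit' (row_mx _ _).
set p3 := phit' (diag x); set p4 := phit' _.
rewrite (_ : - (- p1 - p2 + p3 + p4) = - p3 + ((p1 + p2) + - p4)); last by ring.
by rewrite !cexpD -[RHS]mulrA -[in RHS]mulrA.
Qed.

Lemma dexpands_dfun x al be (ft gt : 'rV[K]_N -> K) :
  (forall u, ft (row_mx x (conjv x + conjv u)) = monom be (conjv u)) ->
  (forall u, gt (row_mx (x + u) (conjv x)) = monom al u) ->
  dexpands (dfun ft gt x) (single (mjoin al be) 1).
Proof.
move=> hf hg; apply: dexpands_ext (dexpands_monom 1 (mjoin al be)) => // u.
by rewrite /dfun hf hg mul1r monom_mjoin mulrC.
Qed.

Lemma A_op_coef_ext x l al be (ft gt : 'rV[K]_N -> K) : U x ->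
  (forall u, ft (row_mx x (conjv x + conjv u)) = monom be (conjv u)) ->
  (forall u, gt (row_mx (x + u) (conjv x)) = monom al u) ->
  (l`!%:R)^-1 * A_op phi phit phit' l ft gt x = coef_ext l al be (diag x).
Proof.
move=> Ux hf hg; rewrite /coef_ext bt_diag // /A_op; congr (_ * (_ * _)).
apply: eq_bigr => m _; congr (_ / _).
have h := dexpandsM
  (dexpandsM (dexpands_conv_pow m (dexpands_cfun Ux)) (dexpands_dfun hf hg))
  (dexpands_cfun' Ux).
have hk k : dexpands (iter k (Lap phi x) (fun u => cfun phi phit x u ^+ m * dfun ft gt x u
     * cfun' phi phit' x u))
   (iter k (lap_coef (levi_inv_ext (diag x))) (integrand_coef (diag x) m al be)).
  elim: k => [//|k IH] /=; apply: dexpands_ext (dexpands_lap (levi_inv_ext (diag x)) IH) => // u.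
  by apply: eq_bigr => i _; apply: eq_bigr => j _; rewrite levi_inv_diag.
exact: dexpands_at (hk _).
Qed.

Lemma multi_ordK l (al : multi n) : (mabs al <= l)%N ->
  multi_of_ord [ffun i => inord (al i) : 'I_l.+1] = al.
Proof.
move=> h; apply/ffunP => i; rewrite !ffunE inordK // ltnS.
exact: leq_trans (mabs_ge al i) h.
Qed.

(** The test functions are f(z) = (conj z - conj x)^be and g(z) = (z - x)^al: all
    their derivatives at x vanish except those of index be and al. *)
Lemma coef_ext_diag (a : nat -> multi n -> multi n -> 'rV[K]_N -> K) l al be x :
  bidiff_coefficients U phi phit phit' a -> U x ->
  (mabs al <= l)%N -> (mabs be <= l)%N -> a l al be (diag x) = coef_ext l al be (diag x).
Proof.
move=> [_ H] Ux hal hbe.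
pose ft (w : 'rV[K]_N) := \prod_i (w 0 (rshift n i) - conjc (x 0 i)) ^+ be i.
pose gt (w : 'rV[K]_N) := \prod_i (w 0 (lshift n i) - x 0 i) ^+ al i.
pose f y := ft (diag y); pose g y := gt (diag y).
have fE u : f (x + u) = monom be (conjv u).
  apply: eq_bigr => i _; rewrite diag_r mxE rmorphD /= mxE.
  by rewrite [_ + conjc (u 0 i)]addrC addrK.
have gE u : g (x + u) = monom al u.
  by apply: eq_bigr => i _; rewrite diag_l mxE addrAC subrr add0r.
have hf : hol_extension U setT f ft.
  split=> // w _; apply: analytic_holomorphic; apply: analytic_prod => i; apply: analyticX.
  by apply: analyticD; [exact: analytic_coord | exact: analytic_cst].
have hg : hol_extension U setT g gt.
  split=> // w _; apply: analytic_holomorphic; apply: analytic_prod => i; apply: analyticX.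
  by apply: analyticD; [exact: analytic_coord | exact: analytic_cst].
have := H l setT f g ft gt openT (fun _ _ => I) hf hg x Ux.
rewrite (@A_op_coef_ext x l al be) //; first last.
- by move=> u; apply: eq_bigr => i _; rewrite row_mxEl mxE addrAC subrr add0r.
- by move=> u; apply: eq_bigr => i _; rewrite row_mxEr !mxE addrAC subrr add0r.
move=> ->.
have dfE be' : dzbars be' f x = if be' == be then (mfact be)%:R else 0.
  rewrite -dzbars_monom -[x in LHS]addr0.
  rewrite -[LHS]/((fun u => dzbars be' f (x + u)) 0) dzbars_shift.
  by congr (dzbars _ _ _); apply/funext => u; apply: fE.
have dgE al' : dzs al' g x = if al' == al then (mfact al)%:R else 0.
  rewrite -dzs_monom -[x in LHS]addr0.
  rewrite -[LHS]/((fun u => dzs al' g (x + u)) 0) dzs_shift.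
  by congr (dzs _ _ _); apply/funext => u; apply: gE.
pose alo : {ffun 'I_n -> 'I_l.+1} := [ffun i => inord (al i)].
pose beo : {ffun 'I_n -> 'I_l.+1} := [ffun i => inord (be i)].
have aloE : multi_of_ord alo = al := multi_ordK hal.
have beoE : multi_of_ord beo = be := multi_ordK hbe.
have inj := @multi_of_ord_inj n l.+1.
have mf0 (de : multi n) : ((mfact de)%:R : K) != 0.
  by rewrite pnatr_eq0 -lt0n /mfact prodn_gt0 // => i; rewrite fact_gt0.
rewrite (bigD1 alo) /=; last by rewrite aloE.
rewrite [X in _ + X]big1 ?addr0 => [|al' /andP[_ ne]]; last first.
  apply: big1 => be' _; rewrite dgE -[al in _ == al]aloE (inj_eq inj) (negPf ne).
  by rewrite mulr0 mul0r mulr0.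
rewrite (bigD1 beo) /=; last by rewrite beoE.
rewrite big1 ?addr0 => [|be' /andP[_ ne]]; last first.
  by rewrite dfE -[be in _ == be]beoE (inj_eq inj) (negPf ne) !mul0r mulr0.
rewrite aloE beoE dfE dgE !eqxx natrM.
by rewrite [_ * (mfact al)%:R]mulrC divff ?mulf_neq0 // mulr1.
Qed.

End Diagonal.

End Explicit.

(** * Estimates *)

Section LocalBound.
Variables (R : realType) (n : nat).
Local Notation K := (CC R).
Local Notation N := (n + n)%N.
Variables (phit phit' bt : 'rV[K]_N -> K) (a : 'rV[K]_N).
Hypotheses (phi_a : analytic phit a) (phi'_a : analytic phit' a) (bt_a : analytic bt a).

Lemma analytic_sum_bounded (T : Type) (s : seq T) (F : T -> 'rV[K]_N -> K) :
  (forall t, analytic (F t) a) ->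
  exists r B : R, 0 < r /\ forall w, polydisc a r w -> \sum_(t <- s) cmod (F t w) <= B.
Proof.
move=> h; elim: s => [|t s [r [B [r0 IH]]]].
  by exists 1, 0; split=> // w _; rewrite big_nil.
have [r' [B' [r'0 hB]]] := analytic_bounded (h t).
have m0 : 0 < Num.min r r' by rewrite lt_min r0.
exists (Num.min r r'), (B' + B); split=> // w hw; rewrite big_cons lerD //.
  by apply: hB (polydisc_le _ hw); rewrite ge_min lexx orbT.
by apply: IH (polydisc_le _ hw); rewrite ge_min lexx.
Qed.

(** Lower bounds by 1 let the constants be raised to larger exponents at will,
    and r <= 1 bounds the monomial u^al v^be by 1. *)
Lemma coef_ext_constants : exists r Mc Mc' MH Mb : R,
  [/\ 0 < r <= 1, 1 <= Mc, 1 <= Mc', 0 <= MH & 1 <= Mb] /\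
  forall w, polydisc a r w -> [/\ l1_le (cfun_coef phit w) r Mc,
    l1_le (cfun'_coef phit phit' w) r Mc',
    \sum_i \sum_j cmod (levi_inv_ext phit bt w i j) <= MH & cmod (bt w) <= Mb].
Proof.
have [r1 [A [B [r10 h1]]]] := coef_field2 (cfun_coef_field phi_a) (cfun'_coef_field phi_a phi'_a).
have [r2 [Mb [r20 h2]]] := analytic_bounded bt_a.
have [r3 [MH [r30 h3]]] := analytic_sum_bounded
  [seq (i, j) | i <- index_enum 'I_n, j <- index_enum 'I_n]
  (fun p => levi_inv_ext_analytic phi_a bt_a p.1 p.2).
pose r := Num.min (Num.min r1 r2) (Num.min r3 1).
have r0 : 0 < r by rewrite !lt_min r10 r20 r30 ltr01.
have rr1 : r <= r1 by rewrite !ge_min lexx.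
have rr2 : r <= r2 by rewrite !ge_min lexx ?orbT.
have rr3 : r <= r3 by rewrite !ge_min lexx ?orbT.
have rr4 : r <= 1 by rewrite !ge_min lexx ?orbT.
exists r, (Num.max 1 A), (Num.max 1 B), (Num.max 0 MH), (Num.max 1 Mb).
split; first by rewrite r0 rr4 !le_max !lexx.
move=> w hw; have [hA hB] := h1 w (polydisc_le rr1 hw); split.
- by apply: l1_le_trans hA; rewrite ?(ltW r0) // le_max lexx orbT.
- by apply: l1_le_trans hB; rewrite ?(ltW r0) // le_max lexx orbT.
- rewrite le_max; apply/orP; right.
  have := h3 w (polydisc_le rr3 hw); congr (_ <= _).
  by rewrite big_allpairs_dep /=.
by rewrite le_max; apply/orP; right; apply: h2 (polydisc_le rr2 hw).
Qed.

Lemma fact_ratio_le (m l : nat) :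
  (((l + m)`! * (l + m)`!)%:R / (m`! * (l + m)`!)%N%:R / l`!%:R : R) <= 2 ^+ (l + m).
Proof.
have f0 k : (k`!%:R : R) != 0 by rewrite pnatr_eq0 -lt0n fact_gt0.
rewrite [leLHS](_ : _ = 'C(l + m, l)%:R).
  rewrite -natrX ler_nat (_ : 2 ^ (l + m) = (1 + 1) ^ (l + m))%N // expnDn.
  rewrite (bigD1 (inord l)) //= inordK ?ltnS ?leq_addr //.
  by rewrite !exp1n !muln1 leq_addr.
have := @bin_fact (l + m) l; rewrite leq_addr addKn => /(_ isT) => E.
rewrite -[in LHS]E !natrM; field.
by rewrite !f0 pnatr_eq0 -lt0n bin_gt0 leq_addr.
Qed.

Lemma ord_bounds l (m : 'I_(2 * l).+1) : (l + m <= 3 * l)%N /\ (m <= 3 * l)%N.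
Proof. by have := ltn_ord m; lia. Qed.

Lemma odd_le_pow4 l : ((2 * l).+1 <= 4 ^ l)%N.
Proof. by elim: l => // l IH; rewrite expnS; lia. Qed.

(** With k = l + m, the m-th term is at most Mc^m Mc' (4 Hs/r^2)^k k! k!/(m! k! l!)
    and the ratio of factorials is the binomial of k and l, at most 2^k. Since
    k and m are at most 3 l, each term is at most Mc' (Mc Q)^(3l), and the number
    2 l + 1 of terms is at most 4^l. *)
Lemma coef_ext_local_bound : exists r C : R, 0 < r /\
  forall w, polydisc a r w -> forall l al be,
    cmod (coef_ext phit phit' bt l al be w) <= C ^+ l.+1.
Proof.
have [r [Mc [Mc' [MH [Mb [[/andP[r0 r1] Mc1 Mc'1 MH0 Mb1] hw]]]]]] := coef_ext_constants.
(* 8 = 4 * 2: the 4 of lap_coef_bound0 times the 2 of the binomial bound. *)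
pose Q := 8 * MH / r ^+ 2 + 1.
have rr0 : 0 < r ^+ 2 by rewrite exprn_gt0.
have Q1 : 1 <= Q by rewrite lerDr divr_ge0 ?mulr_ge0 // ltW.
pose Y := 4 * (Mc * Q) ^+ 3.
have McQ1 : 1 <= Mc * Q by rewrite -[1]mulr1 ler_pM.
have Y1 : 1 <= Y.
  have : 1 <= (Mc * Q) ^+ 3 by apply: exprn_ege1.
  rewrite /Y; lra.
exists r, (Mb * Mc' * Y); split=> // w /hw{hw}[hc hc' hH hb] l al be.
set Hs := \sum_i _ in hH.
have Hs0 : 0 <= Hs by rewrite sumr_ge0 // => i _; rewrite sumr_ge0 // => j _; apply: cmod_ge0.
have term (m : 'I_(2 * l).+1) :
    cmod (iter (l + m)%N (lap_coef (levi_inv_ext phit bt w))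
      (integrand_coef phit phit' w m al be) (mi0 N)
      / (m`! * (l + m)`!)%N%:R) / l`!%:R <= Mc' * (Mc * Q) ^+ (3 * l).
  set k := (l + m)%N.
  have [hk hm] : (k <= 3 * l)%N /\ (m <= 3 * l)%N := ord_bounds m.
  have totB : l1_le (integrand_coef phit phit' w m al be) r (Mc ^+ m * 1 * Mc').
    apply: l1_le_conv (ltW r0) _ hc'; apply: l1_le_conv (ltW r0) (l1_le_conv_pow m (ltW r0) hc) _.
    apply: (l1_le_trans (ltW r0) (lexx r) _ (l1_le_single _ 1 (ltW r0))).
    by rewrite cmod1 mul1r exprn_ile1 // ltW.
  have B0 := sums_le_ge0 totB.
  have := lap_coef_bound0 (levi_inv_ext phit bt w) k r0 (fun ga => sums_le_term ga totB) B0.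
  rewrite -/Hs mulr1 => hb0.
  rewrite cmodM cmodV cmod_nat.
  have f0 j : 0 < (j`!%:R : R) by rewrite ltr0n fact_gt0.
  have mk0 : 0 < ((m`! * k`!)%N%:R : R) by rewrite natrM mulr_gt0.
  apply: (le_trans (y := (Mc ^+ m * Mc' * (4 * Hs / r ^+ 2) ^+ k) * 2 ^+ k)).
    apply: (le_trans (y := (Mc ^+ m * Mc' * (4 * Hs / r ^+ 2) ^+ k) *
       ((k`! * k`!)%:R / (m`! * k`!)%N%:R / l`!%:R))).
      rewrite !mulrA ler_wpM2r ?invr_ge0 ?(ltW (f0 l)) //.
      by rewrite ler_wpM2r ?invr_ge0 ?(ltW mk0).
    apply: ler_wpM2l; last exact: fact_ratio_le.
    by rewrite mulr_ge0 ?mulr_ge0 ?exprn_ge0 ?mulr_ge0 ?invr_ge0 ?(ltW rr0) //; lra.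
  rewrite -mulrA -exprMn.
  have -> : 4 * Hs / r ^+ 2 * 2 = 8 * Hs / r ^+ 2 by field; rewrite gt_eqF.
  have qQ : (8 * Hs / r ^+ 2) ^+ k <= Q ^+ (3 * l).
    apply: (le_trans (y := Q ^+ k)).
      apply: lerXn2r; rewrite ?nnegrE; [|lra|].
        by rewrite !mulr_ge0 ?invr_ge0 // ltW.
      apply: (le_trans (y := 8 * MH / r ^+ 2)); last by rewrite lerDl.
      by rewrite ler_wpM2r ?invr_ge0 ?(ltW rr0) // ler_wpM2l.
    by apply: ler_weXn2l.
  have mM : Mc ^+ m <= Mc ^+ (3 * l).
    by apply: ler_weXn2l.
  rewrite [Mc ^+ m * Mc']mulrC -[leLHS]mulrA [in leRHS]exprMn.
  apply: ler_wpM2l; first lra.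
  by apply: ler_pM => //; rewrite exprn_ge0 ?mulr_ge0 ?invr_ge0 ?(ltW rr0) //; lra.
have f0 : 0 < (l`!%:R : R) by rewrite ltr0n fact_gt0.
rewrite /coef_ext cmodM cmodV cmod_nat cmodM mulrCA.
apply: (le_trans (y := Mb * (Mc' * Y ^+ l))).
  apply: ler_pM; rewrite ?cmod_ge0 ?mulr_ge0 ?invr_ge0 ?cmod_ge0 ?(ltW f0) //.
  rewrite mulrC.
  apply: (le_trans (y := \sum_(m < (2 * l).+1) Mc' * (Mc * Q) ^+ (3 * l))).
    apply: le_trans (_ : (\sum_(m < (2 * l).+1)
      cmod (iter (l + m)%N (lap_coef (levi_inv_ext phit bt w))
      (integrand_coef phit phit' w m al be) (mi0 N)
      / (m`! * (l + m)`!)%N%:R)) / l`!%:R <= _).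
      by rewrite ler_wpM2r ?invr_ge0 ?(ltW f0) // cmod_sum.
    by rewrite mulr_suml; apply: ler_sum => m _; apply: term.
  rewrite sumr_const card_ord -mulr_natr -mulrA; apply: ler_wpM2l; first lra.
  rewrite /Y [leRHS]exprMn -[in leRHS]exprM [leLHS]mulrC.
  apply: ler_wpM2r; first by rewrite exprn_ge0 //; lra.
  by rewrite -natrX ler_nat odd_le_pow4.
have Z1 : 1 <= Mb * Mc' by rewrite -[1]mulr1 ler_pM.
rewrite mulrA [leRHS]exprMn; apply: ler_pM.
- lra.
- by rewrite exprn_ge0 //; lra.
- by rewrite -[leLHS]expr1; apply: ler_weXn2l.
- by apply: ler_weXn2l.
Qed.

End LocalBound.

Lemma posdef_det (R : realType) (n : nat) (A : 'M[CC R]_n) : posdef A -> \det A != 0.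
Proof.
move=> pA; apply/negP => /eqP d0.
have /det0P[v v0 vA] : \det A == 0 by rewrite d0.
have := pA v v0; rewrite exchange_big /= big1 ?ltxx // => j _.
rewrite -mulr_suml (_ : \sum_i A i j * v 0 i = (v *m A) 0 j).
  by rewrite vA mxE mul0r.
by rewrite mxE; apply: eq_bigr => i _; rewrite mulrC.
Qed.

(** Monotonicity in C makes P C hold near each point for all large C, the form in
    which compactness yields one C for the whole of K. *)
Lemma compact_uniform_bound (R : realType) (N : nat) (K W : set 'rV[CC R]_N)
    (P : R -> 'rV[CC R]_N -> Prop) : compact K -> K `<=` W ->
  (forall (C C' : R) w, C <= C' -> P C w -> P C' w) ->
  (forall w, W w -> exists r C : R, 0 < r /\ forall w', polydisc w r w' -> P C w') ->
  exists C : R, 0 < C /\ forall w, K w -> P C w.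
Proof.
move=> /compact_near_coveringP Kc KW mono loc.
have : \forall C \near +oo%R, K `<=` P C.
  apply: (Kc R (pinfty_nbhs R) P _) => w /KW /loc[r [C [r0 h]]].
  exists (polydisc w r, [set C' | C <= C']) => /=.
    split; first exact: polydisc_nbhs.
    exact: nbhs_pinfty_ge (num_real _).
  by move=> [w' C'] [/= h1 h2]; apply: mono h2 (h _ h1).
move=> [M [_ hM]]; exists (Num.max M 0 + 1); split.
  by rewrite ltr_wpDl // le_max lexx orbT.
by apply: hM; rewrite (le_lt_trans (y := Num.max M 0)) ?ltrDl // le_max lexx.
Qed.

Theorem theorem2p3 (R : realType) (n : nat) (M : complex_manifold R n)
    (L L' : line_bundle M) (h : hermitian_metric L) (h' : hermitian_metric L')
    (M_compact : compact [set: M])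
    (h_analytic : real_analytic_metric h) (h'_analytic : real_analytic_metric h')
    (L_positive : positive_metric h)
    (k : chart R n M) (k_hol : holomorphic_chart k)
    (U_connected : connected (cdom k))
    (s : forall x, fibre L x) (s' : forall x, fibre L' x)
    (s_frame : holomorphic_frame (cdom k) s)
    (s'_frame : holomorphic_frame (cdom k) s')
    (U : set 'rV[CC R]_n) (U_def : U = cmap k @` cdom k)
    (phi phi' : 'rV[CC R]_n -> R)
    (phi_def : phi = weight h k s) (phi'_def : phi' = weight h' k s')
    (phit phit' : 'rV[CC R]_(n + n) -> CC R)
    (phit_ext : hol_extension U (UxUbar U) (fun x => (phi x)%:C) phit)
    (phit'_ext : hol_extension U (UxUbar U) (fun x => (phi' x)%:C) phit')
    (b_ext : exists bt, hol_extension U (UxUbar U) (bfun phi) bt)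
    (a : nat -> multi n -> multi n -> 'rV[CC R]_(n + n) -> CC R)
    (a_coef : bidiff_coefficients U phi phit phit' a)
    (K : set 'rV[CC R]_(n + n)) (K_compact : compact K)
    (K_sub : K `<=` UxUbar U) :
  exists C : R, 0 < C /\
    forall (l : nat) (al be : multi n),
      (mabs al <= l)%N -> (mabs be <= l)%N ->
      forall w, K w -> `|a l al be w| <= (C%:C : CC R) ^+ l.+1.
Proof.
have Uo : open U.
  rewrite U_def; case: k_hol => [[_ + _ _ _] _].
  by rewrite /cimage setIT.
have Uc : connected U.
  rewrite U_def; apply: connected_continuous_connected U_connected _.
  by case: k_hol => [[]].
have pan w : UxUbar U w -> analytic phit w.
  by move=> Ww; apply: holomorphic_analytic; apply: phit_ext.1.
have pan' w : UxUbar U w -> analytic phit' w.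
  by move=> Ww; apply: holomorphic_analytic; apply: phit'_ext.1.
have [bt [bt_hol bt_diag]] := b_ext.
have ban w : UxUbar U w -> analytic bt w.
  by move=> Ww; apply: holomorphic_analytic; apply: bt_hol.
have ldet x : U x -> \det (levi phi x) != 0.
  move=> Ux; apply: posdef_det; rewrite phi_def.
  apply: (L_positive _ _ _ k_hol s_frame).
  by rewrite /cimage setIid -U_def.
have aE l al be w : (mabs al <= l)%N -> (mabs be <= l)%N -> UxUbar U w ->
    a l al be w = coef_ext phit phit' bt l al be w.
  move=> hal hbe Ww; apply/eqP; rewrite -subr_eq0; apply/eqP; move: w Ww.
  apply: (identity_theorem Uo Uc (h := fun w => a l al be w - coef_ext phit phit' bt l al be w)).
    move=> w Ww; apply: analyticD.
      by apply: holomorphic_analytic; apply: a_coef.1.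
    by apply: analyticN; apply: coef_ext_analytic; auto.
  move=> x Ux; apply/eqP; rewrite subr_eq0; apply/eqP.
  exact: (coef_ext_diag Uo pan pan' phit_ext.2 bt_diag ldet a_coef Ux hal hbe).
(* The local constants come from points w, but the identity of a and coef_ext
   holds in UxUbar U only, whence the guard; C >= 0 makes P monotone in C. *)
pose P (C : R) w := 0 <= C /\ (UxUbar U w -> forall l (al be : multi n),
  (mabs al <= l)%N -> (mabs be <= l)%N -> cmod (a l al be w) <= C ^+ l.+1).
have [||C [C0 hC]] := @compact_uniform_bound R (n + n) K (UxUbar U) P K_compact K_sub.
- move=> C C' w CC' [C0 bd]; split=> [|Ww l al be hal hbe]; first exact: le_trans CC'.
  apply: le_trans (bd Ww l al be hal hbe) _.
  by apply: lerXn2r; rewrite // nnegrE // (le_trans C0).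
- move=> w Ww.
  have [r [C [r0 bd]]] := coef_ext_local_bound (pan w Ww) (pan' w Ww) (ban w Ww).
  exists r, `|C|; split=> // w' hw'; split=> // Ww' l al be hal hbe.
  rewrite aE //; apply: le_trans (bd w' hw' l al be) _.
  by rewrite -normrX ler_norm.
exists C; split=> // l al be hal hbe w Kw.
have [_ bd] := hC w Kw.
rewrite cmodE -[C%:C]/(rc C) -rcX rc_le; apply: bd => //; exact: K_sub.
Qed.
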